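(* Let $d\ge1$ be an integer, let $\Omega=\{\boldsymbol{x}_1,\dots,\boldsymbol{x}_n\}$ be a set of $n$ vectors of $\mathbb{R}^d$, and let $\boldsymbol{L}_\varepsilon=[\kappa_\varepsilon(\boldsymbol{x}_i,\boldsymbol{x}_j)]_{i,j=1}^n$ for $\kappa$ a stationary kernel of smoothness order $r$ (possibly $r=\infty$). Let $1\le m\le n$ with $m\le\mathscr{P}_{r-1,d}$ (no upper restriction from $r$ if $r=\infty$), and let $k\le r-1$ be the integer such that $\mathscr{P}_{k-1,d}<m\le\mathscr{P}_{k,d}$. Partition the Wronskian matrix as $$\boldsymbol{W}_{\le k}=\begin{bmatrix}\boldsymbol{W}_{\le k-1}&\boldsymbol{W}_{\urcorner}\\ \boldsymbol{W}_{\llcorner}&\boldsymbol{W}_{\lrcorner}\end{bmatrix}.$$ Then, as $\varepsilon\to0$ ($\varepsilon>0$), the limiting distribution of $\mathcal{X}_\varepsilon\sim|DPP|_m(\boldsymbol{L}_\varepsilon)$ is $$\mathcal{X}_\star\sim|DPP|_m\big(\boldsymbol{V}_k\bar{\boldsymbol{W}}\boldsymbol{V}_k^\top;\boldsymbol{V}_{\le k-1}\big),$$ where $\bar{\boldsymbol{W}}\in\mathbb{R}^{\mathscr{H}_{k,d}\times\mathscr{H}_{k,d}}$ is the Schur complement $$\bar{\boldsymbol{W}}=\boldsymbol{W}_{\lrcorner}-\boldsymbol{W}_{\llcorner}(\boldsymbol{W}_{\le k-1})^{-1}\boldsymbol{W}_{\urcorner}.$$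
   Context: Kernel: a positive definite function $\kappa:\mathbb{R}^d\times\mathbb{R}^d\to\mathbb{R}$ (the matrix $[\kappa(\boldsymbol{y}_i,\boldsymbol{y}_j)]_{i,j}$ is positive definite for any finitely many distinct points). It is stationary if $\kappa(\boldsymbol{x},\boldsymbol{y})=f(\|\boldsymbol{x}-\boldsymbol{y}\|_2)$ for a function $f$; $f$ is assumed analytic in a neighbourhood of $0$, $f(t)=\sum_{i\ge0}f_it^i$, and $\kappa_\varepsilon(\boldsymbol{x},\boldsymbol{y})=f(\varepsilon\|\boldsymbol{x}-\boldsymbol{y}\|_2)$. Smoothness order: $r=\min\{r\ge1:f_{2r-1}\neq0\}$, with $r=\infty$ if all odd coefficients vanish. Polynomials: $\mathscr{H}_{k,d}=\binom{k+d-1}{d-1}$ is the number of monomials of degree $k$ in $d$ variables, $\mathscr{P}_{k,d}=\binom{k+d}{d}$ the number of monomials of degree $\le k$, and $\mathscr{P}_{-1,d}=0$. The multivariate Vandermonde matrix is $\boldsymbol{V}_{\le k}=[\boldsymbol{V}_0\ \boldsymbol{V}_1\cdots\boldsymbol{V}_k]\in\mathbb{R}^{n\times\mathscr{P}_{k,d}}$, where $\boldsymbol{V}_i\in\mathbb{R}^{n\times\mathscr{H}_{i,d}}$ contains the monomials of degree $i$ evaluated at the points of $\Omega$ (fixed arbitrary order within a degree). Wronskian: $\boldsymbol{W}_{\le k}=\left[\frac{\kappa^{(\boldsymbol\alpha,\boldsymbol\beta)}(\boldsymbol{0},\boldsymbol{0})}{\boldsymbol\alpha!\,\boldsymbol\beta!}\right]_{|\boldsymbol\alpha|\le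 k,|\boldsymbol\beta|\le k}\in\mathbb{R}^{\mathscr{P}_{k,d}\times\mathscr{P}_{k,d}}$, with multi-indices in the same order as the columns of $\boldsymbol{V}_{\le k}$, where $\kappa^{(\boldsymbol\alpha,\boldsymbol\beta)}$ is the partial derivative of order $\boldsymbol\alpha$ in the first and $\boldsymbol\beta$ in the second argument. (For $k=0$, $\boldsymbol{V}_{\le-1}$ and $\boldsymbol{W}_{\le-1}$ are empty and $\bar{\boldsymbol{W}}=\boldsymbol{W}_{\le0}$.) Fixed-size L-ensemble: $\mathcal{X}\sim|DPP|_m(\boldsymbol{L})$, $\boldsymbol{L}$ positive semi-definite, means $\mathbf{P}(\mathcal{X}=X)\propto\det(\boldsymbol{L}_X)$ if $|X|=m$, and $0$ otherwise. Fixed-size partial-projection DPP: for $\boldsymbol{L}$ symmetric and $\boldsymbol{V}\in\mathbb{R}^{n\times p}$ of full column rank such that $\boldsymbol{x}^\top\boldsymbol{L}\boldsymbol{x}\ge0$ whenever $\boldsymbol{V}^\top\boldsymbol{x}=0$, $\mathcal{X}\sim|DPP|_m(\boldsymbol{L};\boldsymbol{V})$ means $\mathbf{P}(\mathcal{X}=X)\propto(-1)^p\det\begin{pmatrix}\boldsymbol{L}_X&\boldsymbol{V}_{X,:}\\(\boldsymbol{V}_{X,:})^\top&\boldsymbol{0}\end{pmatrix}$ if $|X|=m$, and $0$ otherwise ($\boldsymbol{L}_X$ is the principal submatrix indexed by $X$, $\boldsymbol{V}_{X,:}$ the submatrix of rows in $X$; for $p=0$ this is the fixed-size L-ensemble of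 $\boldsymbol{L}$). Limiting distribution: $\mathbf{P}(\mathcal{X}_\varepsilon=X)\to\mathbf{P}(\mathcal{X}_\star=X)$ for every $X\subseteq\Omega$.
   Formalization: Two conditions are added so that the limit law exists: W_{≤k-1} is invertible, and the weight defining |DPP|_m(V_k W̄ V_k^T; V_{≤k-1}) is nonzero for some X of size m (this fails e.g. for d=2 and m=n=3 collinear points). *)

(* Defs.v *)
From HB Require Import structures.
From mathcomp Require Import all_boot all_order all_algebra.
From mathcomp Require Import all_classical all_reals all_analysis.

Set Implicit Arguments.
Unset Strict Implicit.
Unset Printing Implicit Defensive.

Import Order.TTheory GRing.Theory Num.Theory.
Import numFieldNormedType.Exports.

Local Open Scope classical_set_scope.
Local Open Scope ring_scope.

Section Kernels.
Variable R : realType.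

Definition enorm d (x : 'rV[R]_d) : R := Num.sqrt (\sum_(i < d) x 0 i ^+ 2).

Definition posdef n (M : 'M[R]_n) : Prop :=
  M^T = M /\ forall u : 'cV[R]_n, u != 0 -> 0 < (u^T *m M *m u) 0 0.

Definition possemidef n (M : 'M[R]_n) : Prop :=
  M^T = M /\ forall u : 'cV[R]_n, 0 <= (u^T *m M *m u) 0 0.

Definition gram_matrix (T : Type) (K : T -> T -> R) n (y : 'I_n -> T) : 'M[R]_n :=
  \matrix_(i, j) K (y i) (y j).

Definition posdef_kernel (T : Type) (K : T -> T -> R) : Prop :=
  forall n (y : 'I_n -> T), injective y -> posdef (gram_matrix K y).

Definition stationary d (K : 'rV[R]_d -> 'rV[R]_d -> R) (f : R -> R) : Prop :=
  forall x y, K x y = f (enorm (x - y)).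

Definition scaled_kernel d (f : R -> R) (eps : R) (x y : 'rV[R]_d) : R :=
  f (eps * enorm (x - y)).

(** [f] is analytic near 0, with Taylor coefficients [c]. *)
Definition analytic_at0 (f : R -> R) (c : R^nat) : Prop :=
  \forall t \near 0, pseries c t @ \oo --> f t.

(** The order [r] is valued in [1, 2, ...] and [oo], the latter being [None]. *)
Definition smoothness_order (c : R^nat) (r : option nat) : Prop :=
  match r with
  | Some s => [/\ (0 < s)%N, c (2 * s - 1)%N != 0 &
                  forall i, (0 < i < s)%N -> c (2 * i - 1)%N = 0]
  | None => forall i, (0 < i)%N -> c (2 * i - 1)%N = 0
  end.

End Kernels.

(** Number of monomials of degree [k] in [d >= 1] variables. *)
Definition nmono (d k : nat) : nat := 'C(k + d - 1, d - 1)%N.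

(** Number of monomials of degree [< k]; thus 0 for [k = 0], and the number of
    monomials of degree [<= k] is [nmono_lt d k.+1]. *)
Definition nmono_lt (d k : nat) : nat := if k is j.+1 then 'C(j + d, d)%N else 0%N.

(** The bounds [k <= r - 1] and [m <= nmono_lt d r], void if [r] is [oo]. *)
Definition lt_order (k : nat) (r : option nat) : bool :=
  if r is Some s then (k < s)%N else true.

Definition le_nmono_order (d m : nat) (r : option nat) : bool :=
  if r is Some s then (m <= nmono_lt d s)%N else true.

Lemma sum_nmono d k : (0 < d)%N -> (\sum_(i < k) nmono d i = nmono_lt d k)%N.
Proof.
case: d => // d _; elim: k => [|k IHk]; first by rewrite big_ord0.
rewrite big_ord_recr /= IHk /nmono addnS !subSS !subn0.
case: k {IHk} => [|k] /=; first by rewrite !binn.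
by rewrite binS addSnnS.
Qed.

Definition midx (d : nat) : Type := {ffun 'I_d -> nat}.

Definition mdegree d (a : midx d) : nat := (\sum_(i < d) a i)%N.

Definition mfact d (a : midx d) : nat := (\prod_(i < d) (a i)`!)%N.

(** [e k] lists, in an arbitrary order and without repetition, the multi-indices
    of degree [k]. *)
Definition midx_enum d (e : forall k, 'I_(nmono d k) -> midx d) : Prop :=
  forall k, injective (e k) /\
            forall a, mdegree a = k <-> exists j, e k j = a.

Lemma midx_enum_exists d : (0 < d)%N ->
  exists e : forall k, 'I_(nmono d k) -> midx d, midx_enum e.
Proof.
case: d => // d _.
pose A k := [set t : d.+1.-tuple 'I_k.+1 | (\sum_(i <- t) i == k)%N]%SET.
have cA k : nmono d.+1 k = #|A k|.
  by rewrite card_ord_partitions /nmono addnS !subSS !subn0 addnC.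
exists (fun k j => [ffun i => val (tnth (enum_val (cast_ord (cA k) j)) i)]).
move=> k; split=> [j1 j2 /ffunP ej|a].
  apply: (@cast_ord_inj _ _ (cA k)); apply/enum_val_inj/eq_from_tnth => i.
  by have := ej i; rewrite !ffunE => /val_inj.
split=> [a_k|[j <-]]; last first.
  have := enum_valP (cast_ord (cA k) j); rewrite inE big_tuple => /eqP jk.
  by apply: etrans jk; apply: eq_bigr => i _; rewrite ffunE.
have lt_a i : (a i < k.+1)%N by rewrite ltnS -a_k /mdegree (bigD1 i) //= leq_addr.
pose t := [tuple Ordinal (lt_a i) | i < d.+1].
have tA : t \in A k.
  rewrite inE big_tuple; apply/eqP; apply: etrans a_k.
  by apply: eq_bigr => i _; rewrite tnth_mktuple.
exists (cast_ord (esym (cA k)) (enum_rank_in tA t)).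
by apply/ffunP => i; rewrite ffunE cast_ordKV enum_rankK_in // tnth_mktuple.
Qed.

Section Wronskian.
Variables (R : realType) (d : nat).
Implicit Types K : 'rV[R]_d -> 'rV[R]_d -> R.

Definition monomial (a : midx d) (x : 'rV[R]_d) : R :=
  \prod_(i < d) x 0 i ^+ a i.

Definition partial_l (i : 'I_d) K : 'rV[R]_d -> 'rV[R]_d -> R :=
  fun x y => 'D_(delta_mx 0 i) (fun z => K z y) x.

Definition partial_r (i : 'I_d) K : 'rV[R]_d -> 'rV[R]_d -> R :=
  fun x y => 'D_(delta_mx 0 i) (fun z => K x z) y.

Definition mpartial (a b : midx d) K : 'rV[R]_d -> 'rV[R]_d -> R :=
  foldr (fun i => iter (a i) (partial_l i))
    (foldr (fun i => iter (b i) (partial_r i)) K (enum 'I_d))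
    (enum 'I_d).

Definition wronskian_entry K (a b : midx d) : R :=
  mpartial a b K 0 0 / ((mfact a)%:R * (mfact b)%:R).

Variable e : forall k, 'I_(nmono d k) -> midx d.

(** In [V_<=k] and [W_<=k] the multi-indices are grouped by degree, and listed
    within each degree in the order of [e]. *)

Definition vandermonde_deg n (x : 'I_n -> 'rV[R]_d) (i : nat) :
    'M[R]_(n, nmono d i) :=
  \matrix_(l, j) monomial (e j) (x l).

(** The matrix of the monomials of degree [< k]; it has no column for [k = 0]. *)
Definition vandermonde_lt n (x : 'I_n -> 'rV[R]_d) (k : nat) :
    'M[R]_(n, \sum_(i < k) nmono d i) :=
  \mxrow_(i < k) vandermonde_deg x i.

Definition wronskian_block K (i j : nat) : 'M[R]_(nmono d i, nmono d j) :=
  \matrix_(a, b) wronskian_entry K (e a) (e b).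

Definition wronskian_lt K (k : nat) :
    'M[R]_(\sum_(i < k) nmono d i, \sum_(i < k) nmono d i) :=
  \mxblock_(i < k, j < k) wronskian_block K i j.

(** The matrix [W_<=k] is [wronskian_lt K k.+1]; its partition after the degrees
    [< k] consists of [wronskian_lt K k], [wronskian_ur K k],
    [wronskian_ll K k] and [wronskian_block K k k]. *)
Definition wronskian_ur K (k : nat) :
    'M[R]_(\sum_(i < k) nmono d i, nmono d k) :=
  \mxcol_(i < k) wronskian_block K i k.

Definition wronskian_ll K (k : nat) :
    'M[R]_(nmono d k, \sum_(i < k) nmono d i) :=
  \mxrow_(j < k) wronskian_block K k j.

Definition wronskian_schur K (k : nat) : 'M[R]_(nmono d k) :=
  wronskian_block K k k
    - wronskian_ll K k *m invmx (wronskian_lt K k) *m wronskian_ur K k.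

End Wronskian.

(** Point processes on ['I_n] are given by their probability mass functions on
    [{set 'I_n}]. *)

Section DPP.
Variables (R : realType) (n : nat).

Definition pmf (P : {set 'I_n} -> R) : Prop :=
  (forall X, 0 <= P X) /\ \sum_(X : {set 'I_n}) P X = 1.

(** [P X] is proportional to [w X] for [#|X| = m], and 0 otherwise. *)
Definition fixed_size_law (m : nat) (w P : {set 'I_n} -> R) : Prop :=
  pmf P /\ exists c : R, forall X, P X = if #|X| == m then c * w X else 0.

(** Without this, no law satisfies [fixed_size_law m w]. *)
Definition normalizable (m : nat) (w : {set 'I_n} -> R) : Prop :=
  exists2 X : {set 'I_n}, #|X| = m & w X != 0.

Definition principal_sub (L : 'M[R]_n) (X : {set 'I_n}) : 'M[R]_#|X| :=
  mxsub (@enum_val _ (mem X)) (@enum_val _ (mem X)) L.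

Definition rows_in p (V : 'M[R]_(n, p)) (X : {set 'I_n}) : 'M[R]_(#|X|, p) :=
  rowsub (@enum_val _ (mem X)) V.

Definition Lensemble (m : nat) (L : 'M[R]_n) (P : {set 'I_n} -> R) : Prop :=
  possemidef L /\ fixed_size_law m (fun X => \det (principal_sub L X)) P.

Definition pp_weight p (L : 'M[R]_n) (V : 'M[R]_(n, p)) (X : {set 'I_n}) : R :=
  (-1) ^+ p *
  \det (block_mx (principal_sub L X) (rows_in V X) (rows_in V X)^T 0).

Definition nonneg_pair p (L : 'M[R]_n) (V : 'M[R]_(n, p)) : Prop :=
  [/\ L^T = L, \rank V = p &
      forall u : 'cV[R]_n, V^T *m u = 0 -> 0 <= (u^T *m L *m u) 0 0].

Definition ppDPP (m : nat) p (L : 'M[R]_n) (V : 'M[R]_(n, p))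
    (P : {set 'I_n} -> R) : Prop :=
  nonneg_pair L V /\ fixed_size_law m (pp_weight L V) P.

End DPP.

(* Main.v *)
Require Import Defs.
From mathcomp Require Import all_boot all_order all_algebra.
From mathcomp Require Import all_classical all_reals all_analysis.
From mathcomp Require Import ring zify.
Import Order.TTheory GRing.Theory Num.Theory.
Import numFieldNormedType.Exports.
Local Open Scope classical_set_scope.
Local Open Scope ring_scope.

Set Implicit Arguments.
Unset Strict Implicit.
Unset Printing Implicit Defensive.

(** Near the diagonal, [kappa x y = f |x - y|] is a polynomial of degree at most
    [2k] in the coordinates of [x] and [y], plus a remainder of size
    [|x - y|^(2k+1)]: the powers of [|x - y|] of odd degree below [2k+1], which
    are not polynomials, are excluded by the smoothness order.  The coefficients
    of this polynomial are the entries of the Wronskian matrix, because the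
    remainder is so flat that its derivatives of order at most [2k] vanish at 0
    ([wronskian_entry_expansion], [kernel_expansion]).

    Hence [L_eps] is, up to [O(eps^(2k+1))], the sum over [i + j <= 2k] of
    [eps^(i+j) V_i W_ij V_j^T] ([bieval_blocks]).  Completing the square with
    respect to the invertible block [W] of the degrees below [k] puts it in the
    form [L_eps = eps^(2k) (S + Y M Y^T)], where [Y] tends to [V_<k], where [M]
    is [W] with its blocks [(i, j)] multiplied by [eps^(i-k) eps^(j-k)], so that
    [M^-1] tends to 0, and where [S] tends to [V_k Wbar V_k^T]: the Schur
    complement [Wbar] is what the square leaves of the block [W_kk]
    ([block_split], [complete_square]).

    For a set [X] of [m] points, the determinant of [S + Y M Y^T] on [X] is, up
    to the factor [(-1)^p det M], the determinant of the matrix [S_X] bordered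
    by [Y_X], its transpose and [- M^-1].  The bordered determinant tends to the
    one that defines the partial-projection weight of [X] ([cvg_pp_weight]).
    The normalising factor [eps^(2km) det M] is the same for all sets of [m]
    points and disappears from the probabilities.  As the determinants of the
    submatrices of [L_eps] are positive, the limit weights have a common sign,
    so that their sum is nonzero as soon as one of them is
    ([total_pp_weight_neq0]). *)

(** * Determinants and positive definite matrices *)

(** Eliminating [C] by column operations makes the matrix block triangular. *)
Lemma det_schur_dr (F : fieldType) m p (A : 'M[F]_m) (B : 'M[F]_(m, p))
    (C : 'M[F]_(p, m)) (D : 'M[F]_p) : D \in unitmx ->
  \det (block_mx A B C D) = \det D * \det (A - B *m invmx D *m C).
Proof.
move=> uD; have := congr1 determinant (mulmx_block A B C D
  (1%:M : 'M[F]_m) 0 (- (invmx D *m C)) (1%:M : 'M[F]_p)).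
rewrite det_mulmx det_lblock !det1 !mulr1 => ->.
rewrite !mulmx1 !mulmx0 !add0r !mulmxN !mulmxA mulmxV // mul1mx subrr.
by rewrite det_ublock mulrC.
Qed.

Lemma det_schur_ul (F : fieldType) m p (A : 'M[F]_m) (B : 'M[F]_(m, p))
    (C : 'M[F]_(p, m)) (D : 'M[F]_p) : A \in unitmx ->
  \det (block_mx A B C D) = \det A * \det (D - C *m invmx A *m B).
Proof.
move=> uA; have := congr1 determinant (mulmx_block A B C D
  (1%:M : 'M[F]_m) (- (invmx A *m B)) 0 (1%:M : 'M[F]_p)).
rewrite det_mulmx det_ublock !det1 !mulr1 => ->.
rewrite !mulmx1 !mulmx0 !addr0 !mulmxN !mulmxA mulmxV // mul1mx addNr.
by rewrite det_lblock addrC.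
Qed.

(** Induction on the size: the Schur complement of the first diagonal entry is
    again positive definite, because it is the quadratic form of the matrix on
    the vectors whose image has a zero first coordinate. *)
Lemma posdef_det_gt0 (R : realType) n (M : 'M[R]_n) :
  posdef M -> 0 < \det M.
Proof.
elim: n M => [|n IHn] M [symM Mgt0]; first by rewrite det_mx00 ltr01.
pose M' : 'M[R]_(1 + n) := M; have defM := submxK M'.
have symM' : M'^T = M' by [].
move: symM'; rewrite -defM tr_block_mx => /eq_block_mx[symA symB _ symD].
set A := ulsubmx M' in defM symA *; set B := ursubmx M' in defM symB *.
set C := dlsubmx M' in defM symB *; set D := drsubmx M' in defM symD *.
have Mgt0' (u : 'cV[R]_(1 + n)) : u != 0 ->
    0 < (u^T *m block_mx A B C D *m u) 0 0 by rewrite defM; apply: Mgt0.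
have detA : 0 < \det A.
  have := Mgt0' (col_mx (1%:M : 'M[R]_1) 0).
  rewrite tr_col_mx mul_row_block mul_row_col !trmx1 !trmx0 !mul1mx !mul0mx.
  rewrite !addr0 mulmx0 addr0 mulmx1 det_mx11; apply.
  by rewrite col_mx_eq0 negb_and matrix_nonzero1.
have uA : A \in unitmx by rewrite unitmxE unitfE gt_eqF.
suff Spd : posdef (D - C *m invmx A *m B).
  have -> : \det M = \det (block_mx A B C D) by rewrite defM.
  by rewrite det_schur_ul // mulr_gt0 // IHn.
split=> [|v v0].
  rewrite linearB /= symD !trmx_mul trmx_inv symA -symB trmxK mulmxA.
  by [].
pose u := col_mx (- (invmx A *m B *m v)) v.
have Mu : block_mx A B C D *m u = col_mx 0 ((D - C *m invmx A *m B) *m v).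
  rewrite mul_block_col !mulmxN !mulmxA mulmxV // mul1mx addNr mulmxBl.
  by rewrite addrC.
have := Mgt0' u; rewrite -mulmxA Mu tr_col_mx mul_row_col mulmx0 add0r mulmxA.
by apply; rewrite col_mx_eq0 negb_and v0 orbT.
Qed.

(** * Entrywise limits of matrices *)

Section MatrixLimits.
Variables (R : realType) (T : Type) (F : set_system T).
Context {FF : Filter F}.

Lemma cvg_sumr I (s : seq I) (P : pred I) (a : I -> T -> R) (l : I -> R) :
  (forall i, P i -> a i t @[t --> F] --> l i) ->
  \sum_(i <- s | P i) a i t @[t --> F] --> \sum_(i <- s | P i) l i.
Proof. by move=> al; apply: cvg_big => //; exact: add_continuous. Qed.

Lemma cvg_prodr I (s : seq I) (P : pred I) (a : I -> T -> R) (l : I -> R) :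
  (forall i, P i -> a i t @[t --> F] --> l i) ->
  \prod_(i <- s | P i) a i t @[t --> F] --> \prod_(i <- s | P i) l i.
Proof. by move=> al; apply: cvg_big => //; exact: mul_continuous. Qed.

Definition mxcvg m n (A : T -> 'M[R]_(m, n)) (L : 'M[R]_(m, n)) : Prop :=
  forall i j, A t i j @[t --> F] --> L i j.

Lemma mxcvg_cst m n (L : 'M[R]_(m, n)) : mxcvg (fun=> L) L.
Proof. by move=> i j; exact: cvg_cst. Qed.

Lemma mxcvg_add m n (A B : T -> 'M[R]_(m, n)) L M :
  mxcvg A L -> mxcvg B M -> mxcvg (fun t => A t + B t) (L + M).
Proof.
move=> AL BM i j; rewrite mxE; under eq_cvg do rewrite mxE.
by apply: cvgD; [exact: AL | exact: BM].
Qed.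

Lemma mxcvg_scale m n (a : T -> R) (A : T -> 'M[R]_(m, n)) l L :
  a t @[t --> F] --> (l : R) -> mxcvg A L -> mxcvg (fun t => a t *: A t) (l *: L).
Proof.
move=> al AL i j; rewrite mxE; under eq_cvg do rewrite mxE.
by apply: cvgM; [exact: al | exact: AL].
Qed.

Lemma mxcvg_opp m n (A : T -> 'M[R]_(m, n)) L :
  mxcvg A L -> mxcvg (fun t => - A t) (- L).
Proof.
move=> AL i j; rewrite mxE; under eq_cvg do rewrite mxE.
by apply: cvgN; exact: AL.
Qed.

Lemma mxcvg_sum I (s : seq I) (P : pred I) m n (A : I -> T -> 'M[R]_(m, n)) L :
  (forall i, P i -> mxcvg (A i) (L i)) ->
  mxcvg (fun t => \sum_(i <- s | P i) A i t) (\sum_(i <- s | P i) L i).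
Proof.
move=> AL i j; rewrite summxE; under eq_cvg do rewrite summxE.
by apply: cvg_sumr => l Pl; exact: AL.
Qed.

Lemma mxcvg_mul m n p (A : T -> 'M[R]_(m, n)) (B : T -> 'M[R]_(n, p)) L M :
  mxcvg A L -> mxcvg B M -> mxcvg (fun t => A t *m B t) (L *m M).
Proof.
move=> AL BM i j; rewrite mxE; under eq_cvg do rewrite mxE.
by apply: cvg_sumr => l _; apply: cvgM; [exact: AL | exact: BM].
Qed.

Lemma mxcvg_tr m n (A : T -> 'M[R]_(m, n)) L :
  mxcvg A L -> mxcvg (fun t => (A t)^T) L^T.
Proof.
by move=> AL i j; rewrite mxE; under eq_cvg do rewrite mxE; exact: AL.
Qed.

Lemma mxcvg_sub m n m' n' (f : 'I_m' -> 'I_m) (g : 'I_n' -> 'I_n)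
    (A : T -> 'M[R]_(m, n)) L :
  mxcvg A L -> mxcvg (fun t => mxsub f g (A t)) (mxsub f g L).
Proof.
by move=> AL i j; rewrite mxE; under eq_cvg do rewrite mxE; exact: AL.
Qed.

Lemma mxcvg_row m n1 n2 (A : T -> 'M[R]_(m, n1)) (B : T -> 'M[R]_(m, n2)) L M :
  mxcvg A L -> mxcvg B M -> mxcvg (fun t => row_mx (A t) (B t)) (row_mx L M).
Proof.
move=> AL BM i j; rewrite mxE; under eq_cvg do rewrite mxE.
by case: (fintype.split j) => l; [exact: AL | exact: BM].
Qed.

Lemma mxcvg_block m1 m2 n1 n2 (A : T -> 'M[R]_(m1, n1))
    (B : T -> 'M[R]_(m1, n2)) (C : T -> 'M[R]_(m2, n1))
    (D : T -> 'M[R]_(m2, n2)) A0 B0 C0 D0 :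
  mxcvg A A0 -> mxcvg B B0 -> mxcvg C C0 -> mxcvg D D0 ->
  mxcvg (fun t => block_mx (A t) (B t) (C t) (D t)) (block_mx A0 B0 C0 D0).
Proof.
move=> AA BB CC DD i j; rewrite mxE; under eq_cvg do rewrite mxE.
by case: (fintype.split i) => l; apply: mxcvg_row.
Qed.

Lemma cvg_det n (A : T -> 'M[R]_n) L :
  mxcvg A L -> \det (A t) @[t --> F] --> \det L.
Proof.
move=> AL; apply: cvg_sumr => s _; apply: cvgM; first exact: cvg_cst.
by apply: cvg_prodr => i _; exact: AL.
Qed.

Lemma mxcvg_adj n (A : T -> 'M[R]_n) L :
  mxcvg A L -> mxcvg (fun t => \adj (A t)) (\adj L).
Proof.
move=> AL i j; rewrite mxE; under eq_cvg do rewrite mxE.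
apply: cvgM; first exact: cvg_cst.
apply: cvg_det => a b; rewrite !mxE; under eq_cvg do rewrite !mxE.
exact: AL.
Qed.

End MatrixLimits.

(** * Fixed-size laws *)

(** The quadratic form of the submatrix is that of the full matrix on vectors
    extended by zero. *)
Lemma posdef_mxsub (R : realType) m n (f : 'I_m -> 'I_n) (M : 'M[R]_n) :
  injective f -> posdef M -> posdef (mxsub f f M).
Proof.
move=> f_inj [symM Mgt0]; split=> [|u u0].
  by apply/matrixP => i j; rewrite !mxE -[in RHS]symM mxE.
have f1 : mxsub f f (1%:M : 'M[R]_n) = 1%:M.
  by apply/matrixP => i j; rewrite !mxE (inj_eq f_inj).
pose w := colsub f (1%:M : 'M[R]_n) *m u.
have w0 : w != 0.
  apply: contraNneq u0 => w0; rewrite -(mul1mx u) -f1 -[X in mxsub _ _ X]mul1mx.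
  by rewrite mxsub_mul -mulmxA -/w w0 mulmx0.
suff -> : mxsub f f M = (colsub f 1%:M)^T *m M *m colsub f 1%:M.
  by rewrite !mulmxA -trmx_mul -mulmxA; apply: Mgt0.
have -> : (colsub f (1%:M : 'M[R]_n))^T = rowsub f 1%:M.
  by apply/matrixP => i j; rewrite !mxE eq_sym.
rewrite -mulmxA mulmx_colsub mulmx1 mul_rowsub_mx mul1mx.
by apply/matrixP => i j; rewrite !mxE.
Qed.

Section FixedSizeLaws.
Variables (R : realType) (n m : nat).
Implicit Types (w P : {set 'I_n} -> R) (X : {set 'I_n}).

Definition total_weight w : R := \sum_(X : {set 'I_n} | #|X| == m) w X.

(** The constant of proportionality is determined by the total mass being 1. *)
Lemma fixed_size_lawE w P X : fixed_size_law m w P ->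
  P X = if #|X| == m then w X / total_weight w else 0.
Proof.
case=> -[_ P1] [c Pc]; rewrite Pc; case: eqP => // _.
have cw : c * total_weight w = 1.
  rewrite -P1 /total_weight mulr_sumr big_mkcond /=; apply: eq_bigr => Y _.
  by rewrite Pc; case: ifP.
have w0 : total_weight w != 0.
  by apply: contra_eq_neq cw => ->; rewrite mulr0 eq_sym oner_neq0.
by rewrite mulrC; congr (_ * _); apply: (mulIf w0); rewrite cw mulVf.
Qed.

Lemma fixed_size_law_exists w : total_weight w != 0 ->
  (forall X, #|X| = m -> 0 <= w X / total_weight w) ->
  fixed_size_law m w (fun X => if #|X| == m then w X / total_weight w else 0).
Proof.
move=> w0 w_ge0; split; last first.
  exists (total_weight w)^-1 => X; case: ifP => // _; exact: mulrC.
split=> [X|]; first by case: eqP => // /w_ge0.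
by rewrite -big_mkcond /= -mulr_suml mulfV.
Qed.

End FixedSizeLaws.

Lemma Lensemble_posdef (R : realType) n m (L : 'M[R]_n) : (m <= n)%N ->
  posdef L -> exists P, Lensemble m L P.
Proof.
move=> le_mn Lpd; pose w (X : {set 'I_n}) := \det (principal_sub L X).
have w_gt0 X : 0 < w X by apply/posdef_det_gt0/posdef_mxsub => //; exact: enum_val_inj.
have [X0 cX0] : exists X0 : {set 'I_n}, #|X0| = m.
  have /set0Pn[X] : [set X : {set 'I_n} | #|X| == m]%SET != finset.set0.
    by rewrite -card_gt0 card_draws card_ord bin_gt0.
  by rewrite finset.in_set => /eqP cX; exists X.
have Z_gt0 : 0 < total_weight m w.
  rewrite /total_weight (bigD1 X0) ?cX0 //= ltr_pwDl //.
  by apply: sumr_ge0 => X _; exact: ltW.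
eexists; split; last first.
  apply: fixed_size_law_exists; first by rewrite gt_eqF.
  by move=> X _; apply: divr_ge0; apply: ltW; [exact: w_gt0 | exact: Z_gt0].
case: Lpd => symL Lgt0; split=> // u; have [->|/Lgt0/ltW//] := eqVneq u 0.
by rewrite mulmx0 mxE.
Qed.

(** * From an asymptotic splitting to a partial-projection DPP *)

(** In [L = rho (S + Y M Y^T)], the matrix [M] is large (its inverse tends to 0),
    so that the directions of the range of [Y] dominate in the limit: this is what
    turns an L-ensemble into a partial-projection DPP. *)
Section PartialProjectionLimit.
Variables (R : realType) (n p m : nat).
Variables (L S : R -> 'M[R]_n) (Y : R -> 'M[R]_(n, p)) (M : R -> 'M[R]_p).
Variables (rho : R -> R) (S0 : 'M[R]_n) (V : 'M[R]_(n, p)).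

Hypothesis L_pd : forall eps : R, 0 < eps -> posdef (L eps).
Hypothesis L_split : forall eps : R, 0 < eps ->
  L eps = rho eps *: (S eps + Y eps *m M eps *m (Y eps)^T).
Hypothesis rho_gt0 : forall eps : R, 0 < eps -> 0 < rho eps.
Hypothesis M_unit : forall eps : R, 0 < eps -> M eps \in unitmx.
Hypothesis S_lim : mxcvg 0^'+ S S0.
Hypothesis Y_lim : mxcvg 0^'+ Y V.
Hypothesis M_lim : mxcvg 0^'+ (fun eps => invmx (M eps)) 0.

Let w eps (X : {set 'I_n}) := \det (principal_sub (L eps) X).
(** The factor by which the minors of order [m] have to be divided to have a
    finite and nontrivial limit. *)
Let tau eps := \det (M eps) * rho eps ^+ m.

Let tau_neq0 (eps : R) : 0 < eps -> tau eps != 0.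
Proof.
move=> e0; apply: mulf_neq0; last by rewrite expf_neq0 // gt_eqF // rho_gt0.
by have := M_unit e0; rewrite unitmxE unitfE.
Qed.

Let w_gt0 (eps : R) X : 0 < eps -> 0 < w eps X.
Proof.
by move=> e0; apply/posdef_det_gt0/posdef_mxsub; [exact: enum_val_inj | exact: L_pd].
Qed.

(** Bordering by [- M^-1] instead of forming [Y M Y^T] replaces a large matrix by
    one that tends to 0, and the determinant is continuous. *)
Lemma cvg_pp_weight (X : {set 'I_n}) : #|X| = m ->
  w eps X / tau eps @[eps --> 0^'+] --> pp_weight S0 V X.
Proof.
move=> cX.
pose B eps := block_mx (principal_sub (S eps) X) (rows_in (Y eps) X)
  (rows_in (Y eps) X)^T (- invmx (M eps)).
have B_lim : (-1) ^+ p * \det (B eps) @[eps --> 0^'+] --> pp_weight S0 V X.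
  apply: cvgM; first exact: cvg_cst.
  apply: cvg_det; apply: mxcvg_block.
  - exact: mxcvg_sub.
  - exact: mxcvg_sub.
  - by apply: mxcvg_tr; exact: mxcvg_sub.
  - by have := mxcvg_opp M_lim; rewrite oppr0; apply; exact: _.
apply: cvg_trans B_lim; apply: near_eq_cvg; near=> eps.
have e0 : 0 < eps by [].
have uM := M_unit e0.
have uMi : -1 *: invmx (M eps) \in unitmx.
  by rewrite unitmxZ ?unitrN1 // unitmx_inv.
rewrite /B -[- invmx _]scaleN1r det_schur_dr // invmxZ ?unitrN1 // invmxK.
rewrite invrN1 [-1 *: M eps]scaleN1r.
rewrite mulmxN mulNmx opprK.
have -> : principal_sub (S eps) X + rows_in (Y eps) X *m M eps *m
    (rows_in (Y eps) X)^T = (rho eps)^-1 *: principal_sub (L eps) X.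
  rewrite L_split // /principal_sub /rows_in.
  rewrite linearZ /= scalerA mulVf ?gt_eqF ?rho_gt0 // scale1r.
  apply/matrixP => i j; rewrite !mxE; congr (_ + _); apply: eq_bigr => l _.
  by rewrite !mxE; congr (_ * _); apply: eq_bigr => l' _; rewrite !mxE.
rewrite !detZ det_inv -/(w eps X) /tau -cX exprVn invfM.
by rewrite -[_ / \det _ * _]mulrA signrMK mulrA mulrC.
Unshelve. all: by end_near.
Qed.

Hypothesis norm_w : normalizable m (pp_weight S0 V).

(** The sign of [tau] does not depend on the set, and the minors are positive. *)
Let pp_weight_sign (X X' : {set 'I_n}) : #|X| = m -> #|X'| = m ->
  0 <= pp_weight S0 V X * pp_weight S0 V X'.
Proof.
move=> cX cX'.
apply: (cvgr_to_ge (cvgM (cvg_pp_weight cX) (cvg_pp_weight cX'))); near=> eps.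
have e0 : 0 < eps by [].
rewrite /= mulrACA -invfM -expr2 mulr_ge0 ?invr_ge0 ?sqr_ge0 //.
by rewrite mulr_ge0 // ltW // w_gt0.
Unshelve. all: by end_near.
Qed.

Lemma total_pp_weight_neq0 : total_weight m (pp_weight S0 V) != 0.
Proof.
have [X0 cX0 wX0] := norm_w.
suff : 0 < pp_weight S0 V X0 * total_weight m (pp_weight S0 V).
  by apply: contraTneq => ->; rewrite mulr0 ltxx.
rewrite /total_weight (bigD1 X0) ?cX0 //= mulrDr ltr_pwDl //.
  by rewrite -expr2 exprn_even_gt0.
by rewrite mulr_sumr; apply: sumr_ge0 => X /andP[/eqP cX _]; exact: pp_weight_sign.
Qed.

Lemma pp_weight_normalized_ge0 (X : {set 'I_n}) : #|X| = m ->
  0 <= pp_weight S0 V X / total_weight m (pp_weight S0 V).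
Proof.
move=> cX; have Z0 := total_pp_weight_neq0; set Z := total_weight _ _ in Z0 *.
have -> : pp_weight S0 V X / Z = (pp_weight S0 V X * Z) / Z ^+ 2.
  by rewrite expr2 invfM mulrA mulfK.
rewrite divr_ge0 ?sqr_ge0 // /Z /total_weight mulr_sumr.
by apply: sumr_ge0 => X' /eqP cX'; exact: pp_weight_sign.
Qed.

(** In an invertible bordered matrix, the border has independent columns: the
    lower left block of the inverse is a left inverse of it. *)
Lemma rank_of_pp_weight (X : {set 'I_n}) : pp_weight S0 V X != 0 -> \rank V = p.
Proof.
rewrite mulf_eq0 negb_or => /andP[_ det0].
set B := block_mx _ _ _ _ in det0.
have uB : B \in unitmx by rewrite unitmxE unitfE.
have := mulVmx uB; rewrite -[invmx B]submxK /B mulmx_block scalar_mx_block.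
case/eq_block_mx=> _ _ _; rewrite mulmx0 addr0 => AV.
apply/eqP; rewrite eqn_leq rank_leq_col -{1}[p](mxrank1 R) -AV /rows_in rowsubE.
by rewrite mulmxA mxrankM_maxr.
Qed.

(** A vector [u] killed by [V^T] is a limit of vectors [v eps] killed by
    [(Y eps)^T], on which the form of [S] is a positive multiple of that of [L]. *)
Lemma nonneg_pair_limit : S0^T = S0 -> nonneg_pair S0 V.
Proof.
move=> symS0; have [X0 cX0 wX0] := norm_w.
have rkV := rank_of_pp_weight wX0; split=> // u Vu.
have /row_freeP[B VB] : row_free V^T by rewrite /row_free mxrank_tr rkV.
(* A correction of [u] by the range of [B]; using the adjugate of [N] instead of
   its inverse makes [v eps] defined for all [eps], and [det N] tends to 1. *)
pose N eps := (Y eps)^T *m B.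
pose v eps := \det (N eps) *: u - B *m (\adj (N eps) *m ((Y eps)^T *m u)).
have Yv eps : (Y eps)^T *m v eps = 0.
  rewrite /v mulmxBr -scalemxAr !mulmxA -/(N eps) mul_mx_adj.
  by rewrite -!mulmxA mul_scalar_mx subrr.
have N_lim : mxcvg 0^'+ N 1%:M.
  by rewrite -VB; apply: mxcvg_mul; [exact: mxcvg_tr | exact: mxcvg_cst].
have v_lim : mxcvg 0^'+ v u.
  have -> : u = \det (1%:M : 'M[R]_p) *: u
      - B *m (\adj (1%:M : 'M[R]_p) *m (V^T *m u)).
    by rewrite Vu !mulmx0 subr0 det1 scale1r.
  apply: mxcvg_add; last apply: mxcvg_opp.
    by apply: mxcvg_scale; [exact: cvg_det | exact: mxcvg_cst].
  apply: mxcvg_mul; first exact: mxcvg_cst.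
  apply: mxcvg_mul; first exact: mxcvg_adj.
  by apply: mxcvg_mul; [exact: mxcvg_tr | exact: mxcvg_cst].
have q_lim : ((v eps)^T *m S eps *m v eps) 0 0 @[eps --> 0^'+] -->
    (u^T *m S0 *m u) 0 0.
  by apply: mxcvg_mul => //; apply: mxcvg_mul => //; exact: mxcvg_tr.
clearbody v; apply: (cvgr_to_ge q_lim); near=> eps.
have e0 : 0 < eps by [].
have [_ Lgt0] := L_pd e0.
have -> : (v eps)^T *m S eps *m v eps =
    (rho eps)^-1 *: ((v eps)^T *m L eps *m v eps).
  rewrite L_split // -scalemxAr -scalemxAl scalerA mulVf ?gt_eqF ?rho_gt0 //.
  by rewrite scale1r mulmxDr mulmxDl -!mulmxA Yv !mulmx0 addr0.
rewrite mxE; apply: mulr_ge0; first by rewrite invr_ge0 ltW // rho_gt0.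
have [->|/Lgt0/ltW//] := eqVneq (v eps) 0.
by rewrite mulmx0 mxE.
Unshelve. all: by end_near.
Qed.

Theorem partial_projection_limit : S0^T = S0 ->
  exists2 Pstar, ppDPP m S0 V Pstar &
    forall P : R -> {set 'I_n} -> R,
      (forall eps : R, 0 < eps -> Lensemble m (L eps) (P eps)) ->
      forall X, P eps X @[eps --> 0^'+] --> Pstar X.
Proof.
move=> symS0; eexists; first split.
- exact: nonneg_pair_limit.
- by apply: fixed_size_law_exists;
    [exact: total_pp_weight_neq0 | exact: pp_weight_normalized_ge0].
move=> P PL X.
have PE (eps : R) : 0 < eps -> P eps X =
    if #|X| == m then w eps X / total_weight m (w eps) else 0.
  by move=> /PL[_ /fixed_size_lawE].
have [cX|cX] := eqVneq #|X| m; last first.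
  apply: (@cvg_trans _ ((fun=> 0) @ 0^'+)); last exact: cvg_cst.
  apply: near_eq_cvg; near=> eps.
  by rewrite PE ?(negPf cX).
have Z_lim : \sum_(X' : {set 'I_n} | #|X'| == m) w eps X' / tau eps @[eps --> 0^'+] -->
    total_weight m (pp_weight S0 V).
  by apply: cvg_sumr => X' /eqP; exact: cvg_pp_weight.
apply: cvg_trans (cvgM (cvg_pp_weight cX) (cvgV total_pp_weight_neq0 Z_lim)).
apply: near_eq_cvg; near=> eps => /=.
have e0 : 0 < eps by [].
rewrite PE // cX eqxx -mulr_suml -/(total_weight m (w eps)) invf_div.
by rewrite mulrA divfK ?tau_neq0.
Unshelve. all: by end_near.
Qed.
End PartialProjectionLimit.

(** * Power series *)

Section PowerSeries.
Variables (R : realType) (tau : R).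
Hypothesis tau_gt0 : 0 < tau.
Implicit Types (a : R^nat) (t : R).

Definition psum a t : R := limn (pseries a t).

Definition cvg_inside a : Prop := forall t, `|t| < tau -> cvgn (pseries a t).

(** The factor [n.+1] is absorbed by a slight increase of the radius, as
    [n.+1 |t|^n (u - |t|) <= u^n.+1 - |t|^n.+1]. *)
Lemma cvg_inside_diffs a : cvg_inside a -> cvg_inside (pseries_diffs a).
Proof.
move=> ca t ttau.
pose u := (`|t| + tau) / 2; pose v := (u + tau) / 2.
have tu : `|t| < u by rewrite midf_lt.
have u_gt0 : 0 < u by exact: le_lt_trans tu.
have ut : u < tau by rewrite midf_lt.
have uv : u < v by rewrite midf_lt.
have v_gt0 : 0 < v by exact: lt_trans uv.
have vtau : `|v| < tau by rewrite gtr0_norm // midf_lt.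
clearbody u v; have [C [Creal Cb]] := cvg_series_bounded (ca v vtau).
have aC n : `|a n| * v ^+ n <= `|C + 1|.
  rewrite -(gtr0_norm v_gt0) -normrX -normrM; apply: Cb => //.
  by rewrite (lt_le_trans _ (ler_norm _)) // ltrDl.
have tn n : n.+1%:R * `|t| ^+ n <= u ^+ n.+1 / (u - `|t|).
  rewrite ler_pdivlMr ?subr_gt0 // mulrC.
  apply: le_trans (_ : u ^+ n.+1 - `|t| ^+ n.+1 <= _); last first.
    by rewrite gerBl exprn_ge0.
  rewrite subrXX; apply: ler_wpM2l; first by rewrite subr_ge0 ltW.
  rewrite mulr_natl /= -[n.+1 in leLHS]card_ord.
  rewrite -sumr_const; apply: ler_sum => i _.
  have le_in : (i <= n)%N by rewrite -ltnS.
  rewrite -[n in leLHS](subnK le_in) exprD ler_wpM2r ?exprn_ge0 //.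
  by apply: lerXn2r; rewrite ?nnegrE ?normr_ge0 //; exact: ltW.
apply: normed_cvg.
apply: (@series_le_cvg _ _ (geometric (`|C + 1| / v * u / (u - `|t|)) (u / v))).
- by move=> n /=.
- move=> n /=; have [ut0 v0 u0] : [/\ 0 <= u - `|t|, 0 <= v & 0 <= u].
    by rewrite subr_ge0 !ltW.
  by rewrite !mulr_ge0 ?exprn_ge0 ?divr_ge0 ?invr_ge0.
- move=> n /=; rewrite /pseries_diffs normrM normrX normrM normr_nat.
  apply: le_trans (_ : (`|C + 1| / v ^+ n.+1) * (u ^+ n.+1 / (u - `|t|)) <= _).
    rewrite mulrAC mulrC; apply: ler_pM;
      [by [] | by rewrite mulr_ge0 ?exprn_ge0 | | exact: tn].
    by rewrite ler_pdivlMr ?exprn_gt0.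
  rewrite expr_div_n !exprS !invfM le_eqVlt; apply/orP; left; apply/eqP.
  by ring.
- apply: is_cvg_geometric_series.
  by rewrite gtr0_norm ?divr_gt0 // ltr_pdivrMr // mul1r.
Qed.

Lemma is_derive_psum a t : cvg_inside a -> `|t| < tau ->
  is_derive t 1 (psum a) (psum (pseries_diffs a) t).
Proof.
move=> ca ttau; pose u := (`|t| + tau) / 2.
have tu : `|t| < `|u| by rewrite (lt_le_trans _ (ler_norm _)) // midf_lt.
have u_tau : `|u| < tau.
  by rewrite ger0_norm ?midf_lt // divr_ge0 // addr_ge0 // ltW.
have cd := cvg_inside_diffs ca; have cdd := cvg_inside_diffs cd.
by apply: (@pseries_snd_diffs _ _ u) => //; [exact: ca|exact: cd|exact: cdd].
Qed.

(** On power series, multiplying the [i]-th coefficient by [mu + i] is the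
    operator [mu + t d/dt]. *)
Lemma cvg_psum_euler (mu : R) a t : cvg_inside a -> `|t| < tau ->
  pseries (fun i => (mu + i%:R) * a i) t n @[n --> \oo] -->
    mu * psum a t + t * psum (pseries_diffs a) t.
Proof.
move=> ca ttau.
apply: cvg_trans (cvgD (cvgM (cvg_cst mu) (ca t ttau))
  (cvgM (cvg_cst t) (pseries_diffs_equiv (cvg_inside_diffs ca ttau)))).
apply: near_eq_cvg; near=> n => /=.
rewrite fctE /pseries /series /= !mulr_sumr -big_split /=; apply: eq_bigr => i _.
by case: i => [|i] /=; [ring | rewrite exprS; ring].
Unshelve. all: by end_near.
Qed.

Lemma cvg_inside_euler (mu : R) a :
  cvg_inside a -> cvg_inside (fun i => (mu + i%:R) * a i).
Proof. by move=> ca t ttau; apply: cvgP (cvg_psum_euler (mu := mu) ca ttau). Qed.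

Lemma psum_euler (mu : R) a t : cvg_inside a -> `|t| < tau ->
  psum (fun i => (mu + i%:R) * a i) t =
    mu * psum a t + t * psum (pseries_diffs a) t.
Proof. by move=> ca ttau; apply: cvg_lim (cvg_psum_euler ca ttau). Qed.

Lemma psum_bounded a rho : cvg_inside a -> 0 <= rho < tau ->
  exists C, forall t, `|t| <= rho -> `|psum a t| <= C.
Proof.
move=> ca /andP[rho_ge0 rho_tau]; pose u := (rho + tau) / 2.
have u_gt0 : 0 < u by rewrite divr_gt0 // ltr_wpDl.
have u_tau : `|u| < tau by rewrite gtr0_norm // midf_lt.
have cn : cvgn (pseries (fun i => `|a i|) rho).
  apply: is_cvg_pseries_inside_norm (ca _ u_tau) _.
  by rewrite ger0_norm // (lt_le_trans _ (ler_norm _)) // midf_lt.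
exists (limn (pseries (fun i => `|a i|) rho)) => t t_rho.
have t_tau : `|t| < tau by exact: le_lt_trans rho_tau.
apply: (cvgr_to_le (cvg_norm (ca t t_tau))); near=> n.
apply: le_trans (nondecreasing_cvgn_le _ cn n); last first.
  apply/nondecreasing_seqP => i; rewrite /pseries /series /= big_nat_recr //=.
  by rewrite lerDl mulr_ge0 ?exprn_ge0.
rewrite /pseries /series /= (le_trans (ler_norm_sum _ _ _)) //.
apply: ler_sum => i _; rewrite normrM normrX ler_wpM2l //.
by rewrite lerXn2r ?nnegrE.
Unshelve. all: by end_near.
Qed.

Lemma pseries_shift a N t n :
  pseries a t (n + N)%N =
    \sum_(i < N) a i * t ^+ i + t ^+ N * pseries (fun i => a (i + N)%N) t n.
Proof.
rewrite /pseries /series /= !big_mkord addnC big_split_ord /=; congr (_ + _).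
by rewrite mulr_sumr; apply: eq_bigr => i _; rewrite addnC exprD; ring.
Qed.

Lemma cvg_inside_shift a N :
  cvg_inside a -> cvg_inside (fun i => a (i + N)%N).
Proof.
move=> ca t ttau; pose u := (`|t| + tau) / 2.
have tu : `|t| < `|u| by rewrite (lt_le_trans _ (ler_norm _)) // midf_lt.
have u_neq0 : u != 0 by rewrite -normr_gt0 (le_lt_trans _ tu).
have u_tau : `|u| < tau.
  by rewrite ger0_norm ?midf_lt // divr_ge0 // addr_ge0 // ltW.
apply: is_cvg_pseries_inside tu; clearbody u.
have : pseries a u (n + N)%N @[n --> \oo] --> psum a u.
  by rewrite (cvg_shiftn N); exact: ca.
move=> lim; apply: (cvgP (u ^- N * (psum a u - \sum_(i < N) a i * u ^+ i))).
apply: cvg_trans (cvgM (cvg_cst (u ^- N))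
  (cvgB lim (cvg_cst (\sum_(i < N) a i * u ^+ i)))).
apply: near_eq_cvg; near=> n => /=.
by rewrite fctE /= pseries_shift addrC addKr mulKf // expf_neq0.
Unshelve. all: by end_near.
Qed.

Lemma psum_shift a N t : cvg_inside a -> `|t| < tau ->
  psum a t = \sum_(i < N) a i * t ^+ i + t ^+ N * psum (fun i => a (i + N)%N) t.
Proof.
move=> ca ttau; apply: cvg_lim => //.
have : pseries a t (n + N)%N @[n --> \oo] -->
    \sum_(i < N) a i * t ^+ i + t ^+ N * psum (fun i => a (i + N)%N) t.
  have cs : pseries (fun i => a (i + N)%N) t @ \oo --> psum (fun i => a (i + N)%N) t.
    exact: cvg_inside_shift.
  apply: cvg_trans (cvgD (cvg_cst (\sum_(i < N) a i * t ^+ i))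
    (cvgM (cvg_cst (t ^+ N)) cs)).
  by apply: near_eq_cvg; near=> n => /=; rewrite fctE /= pseries_shift.
by rewrite (cvg_shiftn N).
Unshelve. all: by end_near.
Qed.
End PowerSeries.

(** * Derivatives of radial functions *)

Section RadialFamily.
Variables (R : realType) (tau : R) (N : nat) (a : R^nat).
Hypotheses (tau_gt0 : 0 < tau) (a_cvg : cvg_inside tau a).

(** The functions [radial j] are obtained from [t^N psum a t] by iterating
    [h |-> h' / t].  This operator appears because the gradient of [h (|z|)] is
    [(h' / t) (|z|) z]; it lowers the exponent of [t] by 2 and acts on the power
    series factor as [mu + t d/dt], with [mu] the exponent. *)
Fixpoint radial_coef j : R^nat :=
  if j is j'.+1 then
    fun i => (N%:R - (j'.*2)%:R + i%:R) * radial_coef j' i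
  else a.

Definition radial j (t : R) : R := t ^+ N * t^-1 ^+ j.*2 * psum (radial_coef j) t.

Lemma radial_coef_cvg j : cvg_inside tau (radial_coef j).
Proof. by elim: j => [|j IHj] //=; exact: cvg_inside_euler. Qed.

Lemma is_derive_radial j t : 0 < t < tau ->
  is_derive t 1 (radial j) (t * radial j.+1 t).
Proof.
move=> /andP[t_gt0 t_tau]; have t_neq0 : t != 0 by rewrite gt_eqF.
have dP : is_derive t 1 (psum (radial_coef j)) (psum (pseries_diffs (radial_coef j)) t).
  apply: is_derive_psum; [exact: tau_gt0 | exact: radial_coef_cvg |].
  by rewrite gtr0_norm.
have dV : is_derive t 1 (fun u : R => u^-1) (- t ^- 2 *: 1).
  exact: (@is_deriveV _ id).
have dN := is_deriveX N (is_derive_id t (1 : R)).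
have dVj := is_deriveX j.*2 dV.
have -> : radial j = (@id R : R -> R) ^+ N * (fun u : R => u^-1) ^+ j.*2
    * psum (radial_coef j).
  by apply/funext => u; rewrite !fctE.
apply: is_derive_eq (is_deriveM (is_deriveM dN dVj) dP) _.
rewrite /radial (@psum_euler _ tau _ (radial_coef j)) ?gtr0_norm //; last first.
  exact: radial_coef_cvg.
rewrite !fctE /= /GRing.scale /=.
move: (psum _ t) (psum _ t) => p q.
have -> : (j.+1).*2 = (j.*2 + 2)%N by rewrite doubleS addn2.
by case: (N) => [|N']; case: (j.*2) => [|j'] /=;
  rewrite !(exprD, exprS, expr0, expr1) -?exprVn;
  try set A := t ^+ _; try set B := t^-1 ^+ _; field.
Qed.

Lemma radial_bounded j rho : 0 <= rho < tau ->
  exists C, forall t, 0 < t <= rho -> `|radial j t| <= C * (t ^+ N * t^-1 ^+ j.*2).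
Proof.
move=> rho_lt; have [C Cb] := psum_bounded tau_gt0 (@radial_coef_cvg j) rho_lt.
exists C => t /andP[t_gt0 t_rho]; rewrite /radial normrM.
have w_ge0 : 0 <= t ^+ N * t^-1 ^+ j.*2.
  by rewrite mulr_ge0 ?exprn_ge0 // ?invr_ge0 ltW.
rewrite (ger0_norm w_ge0) [leLHS]mulrC; apply: ler_wpM2r => //.
by apply: Cb; rewrite gtr0_norm.
Qed.

End RadialFamily.

Section DirectionalDerivatives.
Variables (R : realType) (d : nat).
Implicit Types (z v : 'rV[R]_d) (g : 'rV[R]_d -> R).

(** Directional derivatives are derivatives of one-variable functions, which gives
    access to the chain rule on the real line. *)
Lemma line_quotientE g z v (F := fun t : R => g (t *: v + z)) :
  (fun t : R => t^-1 *: ((F \o shift 0) (t *: (1 : R)) - F 0)) =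
  (fun t : R => t^-1 *: ((g \o shift z) (t *: v) - g z)).
Proof.
by apply/funext => t /=; rewrite /F addr0 scale0r add0r [t *: 1]mulr1.
Qed.

Lemma is_derive_line g z v D :
  is_derive (0 : R) (1 : R) (fun t : R => g (t *: v + z)) D ->
  is_derive z v g D.
Proof.
move=> [dF DF]; split.
  by move: dF; rewrite /derivable line_quotientE.
by move: DF; rewrite /derive line_quotientE.
Qed.

Lemma is_derive_line_inv g z v D :
  is_derive z v g D ->
  is_derive (0 : R) (1 : R) (fun t : R => g (t *: v + z)) D.
Proof.
move=> [dF DF]; split.
  by move: dF; rewrite /derivable line_quotientE.
by move: DF; rewrite /derive line_quotientE.
Qed.

Definition decr (i : 'I_d) (al : midx d) : midx d :=
  [ffun l => (al l - (l == i))%N].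
Definition incr (i : 'I_d) (al : midx d) : midx d :=
  [ffun l => (al l + (l == i))%N].

(** Along the [i]-th axis only the factor of the [i]-th coordinate varies.  When
    [al i = 0] the truncated [decr i al] is harmless, its coefficient being 0. *)
Lemma is_derive_monomial (al : midx d) (i : 'I_d) z :
  is_derive z (delta_mx 0 i) (monomial al)
    ((al i)%:R * monomial (decr i al) z).
Proof.
pose q := \prod_(l < d | l != i) z 0 l ^+ al l.
apply: is_derive_line.
rewrite [X in is_derive _ _ X _](_ : _ =
    (fun t : R => t + z 0 i) ^+ al i * (fun=> q)); last first.
  apply/funext => t; rewrite /monomial !fctE (bigD1 i) //= !mxE !eqxx /= mulr1.
  congr (_ * _); apply: eq_bigr => l li.
  by rewrite !mxE eqxx (negPf li) mulr0 add0r.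
have dX : is_derive (0 : R) (1 : R) (fun t : R => t + z 0 i) (1 + 0).
  by apply: is_deriveD.
have dc : is_derive (0 : R) (1 : R) (fun=> q : R) 0 by exact: is_derive_cst.
apply: is_derive_eq (is_deriveM (is_deriveX (al i) dX) dc) _.
rewrite !fctE /= /GRing.scale /= mulr0 add0r addr0 mulr1 add0r mulrC -mulrA.
congr (_ * _).
rewrite /monomial (bigD1 i) //= !ffunE eqxx subn1 /q.
congr (_ * _); apply: eq_bigr => l li.
by rewrite !ffunE (negPf li) subn0.
Qed.

Lemma monomial_incr (al : midx d) (i : 'I_d) z :
  monomial (incr i al) z = z 0 i * monomial al z.
Proof.
rewrite /monomial (bigD1 i) //= [in RHS](bigD1 i) //= mulrA !ffunE eqxx addn1 exprS.
by congr (_ * _); apply: eq_bigr => l li; rewrite !ffunE (negPf li) addn0.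
Qed.

Lemma enorm_line z (i : 'I_d) t :
  enorm (t *: delta_mx 0 i + z) = Num.sqrt (enorm z ^+ 2 + (2 * z 0 i * t + t ^+ 2)).
Proof.
rewrite /enorm sqr_sqrtr; last by apply: sumr_ge0 => l _; exact: sqr_ge0.
congr Num.sqrt; rewrite (bigD1 i) //= [in RHS](bigD1 i) //= !mxE !eqxx /= mulr1.
rewrite (eq_bigr (fun l => z 0 l ^+ 2)); first by ring.
by move=> l li; rewrite !mxE eqxx (negPf li) mulr0 add0r.
Qed.

Lemma is_derive_enorm z (i : 'I_d) : 0 < enorm z ->
  is_derive z (delta_mx 0 i) (@enorm R d) (z 0 i / enorm z).
Proof.
move=> z_gt0; apply: is_derive_line.
under [X in is_derive _ _ X _]funext do rewrite enorm_line.
pose u (t : R) := enorm z ^+ 2 + (2 * z 0 i * t + t ^+ 2).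
have u0 : u 0 = enorm z ^+ 2 by rewrite /u mulr0 expr0n /= !addr0.
have du : is_derive (0 : R) (1 : R) u (2 * z 0 i).
  have d1 : is_derive (0 : R) (1 : R) (cst (enorm z ^+ 2) : R -> R) 0.
    exact: is_derive_cst.
  have d2 := is_deriveZ (2 * z 0 i) (is_derive_id (0 : R) 1).
  have d3 := is_deriveX 2 (is_derive_id (0 : R) 1).
  have -> : u = cst (enorm z ^+ 2) + ((2 * z 0 i) *: id + id ^+ 2).
    by apply/funext => t; rewrite !fctE.
  apply: is_derive_eq (is_deriveD d1 (is_deriveD d2 d3)) _.
  by rewrite /= /GRing.scale /= add0r !mulr1 mulr0 addr0.
have ds : is_derive (u 0) 1 Num.sqrt (2 * Num.sqrt (u 0))^-1.
  by apply: is_derive1_sqrt; rewrite u0 exprn_gt0.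
apply: is_derive_eq (is_derive1_comp ds du) _.
rewrite u0 sqrtr_sqr gtr0_norm //; field.
by rewrite gt_eqF.
Qed.

End DirectionalDerivatives.

(** * Euclidean norm and monomials *)

Section EuclideanNorm.
Variables (R : realType) (d : nat).
Implicit Types (z : 'rV[R]_d).

Lemma enorm_ge0 z : 0 <= enorm z. Proof. exact: sqrtr_ge0. Qed.

Lemma coord_le_enorm z i : `|z 0 i| <= enorm z.
Proof.
rewrite -sqrtr_sqr ler_wsqrtr // (bigD1 i) //= lerDl.
by apply: sumr_ge0 => l _; exact: sqr_ge0.
Qed.

Lemma enorm_eq0 z : enorm z = 0 -> z = 0.
Proof.
move=> z0; apply/rowP => i; rewrite mxE; apply/eqP.
by rewrite -normr_le0 -z0 coord_le_enorm.
Qed.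

Lemma enorm0 : enorm (0 : 'rV[R]_d) = 0.
Proof. by rewrite /enorm big1 ?sqrtr0 // => i _; rewrite mxE expr0n. Qed.

Lemma enormN z : enorm (- z) = enorm z.
Proof. by congr Num.sqrt; apply: eq_bigr => i _; rewrite mxE sqrrN. Qed.

Lemma enormZ (t : R) z : 0 <= t -> enorm (t *: z) = t * enorm z.
Proof.
move=> t0; rewrite /enorm -[X in X * _](ger0_norm t0) -sqrtr_sqr -sqrtrM ?sqr_ge0 //.
by rewrite mulr_sumr; congr Num.sqrt; apply: eq_bigr => i _; rewrite mxE exprMn.
Qed.

Lemma norm_monomial_le (al : midx d) z :
  `|monomial al z| <= enorm z ^+ mdegree al.
Proof.
rewrite /monomial /mdegree normr_prod -prodrXr; apply: ler_prod => i _.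
by rewrite normr_ge0 normrX lerXn2r ?nnegrE ?enorm_ge0 ?coord_le_enorm.
Qed.

Lemma enorm_line_near z (i : 'I_d) (rho1 rho2 : R) : rho1 < enorm z < rho2 ->
  \forall t \near (0 : R), rho1 < enorm (t *: delta_mx 0 i + z) < rho2.
Proof.
move=> /andP[lo hi].
have cont : enorm (t *: delta_mx 0 i + z) @[t --> (0 : R)] -->
    Num.sqrt (enorm z ^+ 2 + (2 * z 0 i * 0 + 0 ^+ 2)).
  under eq_cvg do rewrite enorm_line.
  apply: continuous_cvg; first exact: sqrt_continuous.
  apply: cvgD; first exact: cvg_cst.
  apply: cvgD; first by apply: cvgM; [exact: cvg_cst | exact: cvg_id].
  by apply: cvgM; exact: cvg_id.
have E : Num.sqrt (enorm z ^+ 2 + (2 * z 0 i * 0 + 0 ^+ 2)) = enorm z.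
  by rewrite mulr0 expr0n /= !addr0 sqrtr_sqr ger0_norm ?enorm_ge0.
rewrite E in cont.
near=> t; apply/andP; split; near: t.
  exact: (cvgr_gt _ cont _ lo).
exact: (cvgr_lt _ cont _ hi).
Unshelve. all: by end_near.
Qed.

Lemma mdegree_decr (al : midx d) i : (0 < al i)%N ->
  (mdegree (decr i al)).+1 = mdegree al.
Proof.
move=> al_i; rewrite /mdegree (bigD1 i) //= [in RHS](bigD1 i) //= ffunE eqxx subn1.
rewrite -addSn prednK //; congr addn; apply: eq_bigr => l li.
by rewrite ffunE (negPf li) subn0.
Qed.

Lemma mdegree_incr (al : midx d) i : mdegree (incr i al) = (mdegree al).+1.
Proof.
rewrite /mdegree (bigD1 i) //= [in RHS](bigD1 i) //= ffunE eqxx addn1 addSn.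
by congr (_ + _).+1%N; apply: eq_bigr => l li; rewrite ffunE (negPf li) addn0.
Qed.

End EuclideanNorm.

(** * Flat functions *)

Lemma is_derive_quadratic0 (R : realType) (F : R -> R) C : 0 <= C ->
  (\forall t \near 0, `|F t| <= C * t ^+ 2) -> is_derive (0 : R) (1 : R) F 0.
Proof.
move=> C_ge0 Fb.
have F0 : F 0 = 0.
  have := nbhs_singleton Fb; rewrite expr0n mulr0 normr_le0; exact: eqP.
have lim : t^-1 *: ((F \o shift 0) (t *: (1 : R)) - F 0) @[t --> 0^'] --> (0 : R).
  apply/cvgr0Pnorm_lt => eps eps_gt0; near=> t.
  have t_neq0 : t != 0 by near: t; exact: nbhs_dnbhs_neq.
  have Ft : `|F t| <= C * t ^+ 2 by near: t; exact: nbhs_dnbhs.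
  have t_small : `|t| < eps / (C + 1).
    by near: t; apply: dnbhs0_lt; rewrite divr_gt0 // ltr_wpDl.
  rewrite /= F0 subr0 addr0 [t *: 1]mulr1 normrM normfV mulrC.
  rewrite ltr_pdivrMr ?normr_gt0 //; apply: le_lt_trans Ft _.
  rewrite -real_normK ?num_real // expr2 mulrA ltr_pM2r ?normr_gt0 //.
  apply: le_lt_trans (_ : (C + 1) * `|t| < _); first by rewrite ler_wpM2r // lerDl.
  by rewrite mulrC -ltr_pdivlMr // ltr_wpDl.
by split; [exact: cvgP lim | exact: cvg_lim lim].
Unshelve. all: by end_near.
Qed.

Lemma is_derive_seq_sum (R : realType) d I (s : seq I)
    (F : I -> 'rV[R]_d -> R) (D : I -> R) z v :
  (forall u, is_derive z v (F u) (D u)) ->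
  is_derive z v (fun y => \sum_(u <- s) F u y) (\sum_(u <- s) D u).
Proof.
move=> FD; elim: s => [|u s IHs].
  rewrite big_nil (_ : (fun _ => _) = cst 0); first exact: is_derive_cst.
  by apply/funext => y; rewrite big_nil.
rewrite big_cons (_ : (fun _ => _) = F u + (fun y => \sum_(u <- s) F u y)).
  exact: is_deriveD.
by apply/funext => y; rewrite big_cons.
Qed.

(** The remainder of the kernel and its derivatives are, away from 0, sums of terms
    [c z^al h_j(|z|)] where [h_j] is of size [t^(N - 2j)].  The order of a term is
    [|al| + N - 2j], and a partial derivative lowers it by one: it removes a
    coordinate from the monomial, or adds one and replaces [h_j] by [h_(j+1)].
    The exponents [N - 2j] may become negative, so that these terms are not smooth
    at 0; their sum is nevertheless differentiable there as long as its order is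
    at least 2. *)
Section FlatFunctions.
Variables (R : realType) (d N : nat) (rho : R) (h : nat -> R -> R).
Hypothesis rho_le1 : rho <= 1.
Hypothesis h_derive : forall j t, 0 < t < rho ->
  is_derive t 1 (h j) (t * h j.+1 t).
Hypothesis h_bound : forall j, exists C, forall t, 0 < t < rho ->
  `|h j t| <= C * (t ^+ N * t^-1 ^+ j.*2).

Definition radial_term (u : R * midx d * nat) (z : 'rV[R]_d) : R :=
  u.1.1 * monomial u.1.2 z * h u.2 (enorm z).

(** The order of the term is at least [n], written without subtraction.  Terms with
    a zero coefficient arise by differentiating constant factors, and their
    exponents are arbitrary. *)
Definition term_order n (u : R * midx d * nat) : bool :=
  (u.1.1 != 0) ==> (n + u.2.*2 <= mdegree u.1.2 + N)%N.

Definition term_deriv (i : 'I_d) (u : R * midx d * nat) :=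
  [:: (u.1.1 * (u.1.2 i)%:R, decr i u.1.2, u.2); (u.1.1, incr i u.1.2, u.2.+1)].

Lemma term_order_deriv n i u :
  term_order n.+1 u -> all (term_order n) (term_deriv i u).
Proof.
case: u => [[c al] j]; rewrite /term_order /= andbT => /implyP w.
apply/andP; split; apply/implyP.
  rewrite mulf_eq0 negb_or pnatr_eq0 -lt0n => /andP[/w w1 al_i].
  by move: w1; rewrite -(mdegree_decr al_i) !addSn ltnS.
by move=> /w; rewrite mdegree_incr doubleS !addSn !addnS ltnS.
Qed.

Lemma is_derive_radial_term i u z : 0 < enorm z < rho ->
  is_derive z (delta_mx 0 i) (radial_term u)
    (\sum_(v <- term_deriv i u) radial_term v z).
Proof.
case: u => [[c al] j] z_rho; have /andP[z_gt0 _] := z_rho.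
have dm := is_deriveZ c (is_derive_monomial al i z).
have dn : is_derive z (delta_mx 0 i) (fun y : 'rV[R]_d => h j (enorm y))
    (enorm z * h j.+1 (enorm z) * (z 0 i / enorm z)).
  apply: is_derive_line.
  have dl := is_derive_line_inv (is_derive_enorm i z_gt0).
  have E : enorm (0 *: delta_mx 0 i + z) = enorm z by rewrite scale0r add0r.
  by apply: (@is_derive1_comp _ (h j)) dl; rewrite E; exact: h_derive.
have -> : radial_term (c, al, j) =
    (c *: monomial al) * (fun y : 'rV[R]_d => h j (enorm y)).
  by apply/funext => y; rewrite !fctE.
apply: is_derive_eq (is_deriveM dm dn) _.
rewrite /term_deriv !big_cons big_nil /radial_term /= ?fctE monomial_incr.
rewrite /GRing.scale /=; field; by rewrite gt_eqF.
Qed.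

Definition flat n (g : 'rV[R]_d -> R) : Prop :=
  g 0 = 0 /\ exists2 s, all (term_order n) s &
    forall z, 0 < enorm z < rho -> g z = \sum_(u <- s) radial_term u z.

Lemma flat_bound n g : flat n g ->
  exists2 C, 0 <= C & forall z, enorm z < rho -> `|g z| <= C * enorm z ^+ n.
Proof.
move=> [g0 [s s_n gE]].
suff [C C_ge0 Cb] : exists2 C, 0 <= C & forall z, 0 < enorm z < rho ->
    `|\sum_(u <- s) radial_term u z| <= C * enorm z ^+ n.
  exists C => // z z_rho; have [z0|z0] := eqVneq (enorm z) 0.
    by rewrite (enorm_eq0 z0) g0 normr0 mulr_ge0 ?exprn_ge0 ?enorm_ge0.
  have z_gt0 : 0 < enorm z by rewrite lt_def z0 enorm_ge0.
  by rewrite gE ?Cb // z_gt0.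
elim: s s_n {gE} => [|u s IHs] /=.
  by exists 0 => // z _; rewrite big_nil normr0 mul0r.
move=> /andP[u_n /IHs[C C_ge0 Cb]].
have [B Bb] := h_bound u.2.
exists (`|u.1.1| * `|B| + C) => [|z z_rho]; first by rewrite addr_ge0 ?mulr_ge0.
have /andP[z_gt0 z_lt] := z_rho.
rewrite big_cons (le_trans (ler_normD _ _)) // mulrDl lerD ?Cb //.
rewrite /radial_term !normrM -!mulrA; move: u_n; rewrite /term_order.
have [->|c0] /= := eqVneq u.1.1 0; first by rewrite normr0 !mul0r.
move=> u_n; apply: ler_wpM2l => //.
have t_ge0 := ltW z_gt0.
apply: le_trans (_ : enorm z ^+ mdegree u.1.2 *
   (`|B| * (enorm z ^+ N * (enorm z)^-1 ^+ u.2.*2)) <= _).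
  apply: ler_pM => //; first exact: norm_monomial_le.
  apply: le_trans (Bb _ z_rho) _; apply: ler_wpM2r; last exact: ler_norm.
  by rewrite mulr_ge0 ?exprn_ge0 ?invr_ge0.
rewrite mulrCA; apply: ler_wpM2l => //.
rewrite mulrA -exprD exprVn ler_pdivrMr ?exprn_gt0 // -exprD.
by apply: ler_wiXn2l => //; apply: le_trans rho_le1; exact: ltW.
Qed.

Lemma is_derive_radial_terms s g i z :
  (forall y, 0 < enorm y < rho -> g y = \sum_(u <- s) radial_term u y) ->
  0 < enorm z < rho ->
  is_derive z (delta_mx 0 i) g
    (\sum_(v <- flatten [seq term_deriv i u | u <- s]) radial_term v z).
Proof.
move=> gE z_rho; rewrite big_flatten big_map; apply: is_derive_line.
have dz := is_derive_seq_sum s (fun u => is_derive_radial_term i u z_rho).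
apply: near_eq_is_derive (is_derive_line_inv dz).
near=> t; rewrite gE //; near: t; exact: enorm_line_near.
Unshelve. all: by end_near.
Qed.

(** The terms need not be differentiable at 0, but the quadratic bound suffices. *)
Lemma flat_is_derive0 n g i : flat n.+2 g -> 0 < rho ->
  is_derive 0 (delta_mx 0 i) g 0.
Proof.
move=> g_flat rho_gt0; have [C C_ge0 Cb] := flat_bound g_flat.
apply: is_derive_line; apply: (@is_derive_quadratic0 _ _ C) => //.
near=> t.
have t_small : `|t| < rho by near: t; exact: (@nbhs0_lt R R).
have E : enorm (t *: delta_mx 0 i + 0 : 'rV[R]_d) = `|t|.
  rewrite enorm_line enorm0 mxE mulr0 mul0r expr0n !add0r sqrtr_sqr.
  by [].
apply: le_trans (Cb _ _) _; rewrite E //; apply: ler_wpM2l => //.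
rewrite -[leRHS]real_normK ?num_real //.
by apply: ler_wiXn2l => //; apply: le_trans rho_le1; exact: ltW.
Unshelve. all: by end_near.
Qed.

Lemma flat_derive n g i z : flat n.+2 g -> enorm z < rho ->
  is_derive z (delta_mx 0 i) g ('D_(delta_mx 0 i) g z).
Proof.
move=> g_flat z_rho; suff [D dg] : exists D, is_derive z (delta_mx 0 i) g D.
  by have [dg1 dg2] := dg; rewrite dg2.
have [z0|z0] := eqVneq (enorm z) 0.
  exists 0; rewrite (enorm_eq0 z0); apply: flat_is_derive0 g_flat _.
  by rewrite -z0.
have [_ [s _ gE]] := g_flat; eexists; apply: is_derive_radial_terms gE _.
by rewrite z_rho lt_def z0 enorm_ge0.
Qed.

Lemma flat_deriv n g i : 0 < rho ->
  flat n.+2 g -> flat n.+1 (fun z => 'D_(delta_mx 0 i) g z).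
Proof.
move=> rho_gt0 g_flat; split; first by have [] := flat_is_derive0 i g_flat rho_gt0.
have [_ [s s_n gE]] := g_flat.
exists (flatten [seq term_deriv i u | u <- s]).
  elim: s s_n {gE} => //= u s IHs /andP[u_n /IHs s_n].
  by have := term_order_deriv i u_n; rewrite /= s_n !andbT.
by move=> z z_rho; have [] := is_derive_radial_terms i gE z_rho.
Qed.

Lemma flatN n g : flat n g -> flat n (fun z => - g z).
Proof.
move=> [g0 [s s_n gE]]; split; first by rewrite g0 oppr0.
exists [seq (- u.1.1, u.1.2, u.2) | u <- s].
  by rewrite all_map; apply: sub_all s_n => u; rewrite /term_order /= oppr_eq0.
move=> z z_rho; rewrite gE // big_map -sumrN; apply: eq_bigr => u _.
by rewrite /radial_term /= !mulNr.
Qed.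

End FlatFunctions.

(** * Polynomials in two vector variables *)

(** A polynomial is a list of triples [(c, al, be)], which stand for
    [c x^al y^be]; repetitions are allowed, so that sums and products are mere
    operations on lists. *)
Section TwoVariablePolynomials.
Variables (R : realType) (d : nat).
Implicit Types (t : R * midx d * midx d) (s : seq (R * midx d * midx d)).

Definition biterm t (x y : 'rV[R]_d) : R :=
  t.1.1 * monomial t.1.2 x * monomial t.2 y.

Definition bieval s (x y : 'rV[R]_d) : R := \sum_(t <- s) biterm t x y.

Definition bicoef s (al be : midx d) : R :=
  \sum_(t <- s | (t.1.2 == al) && (t.2 == be)) t.1.1.

Definition deriv_l (i : 'I_d) t := (t.1.1 * (t.1.2 i)%:R, decr i t.1.2, t.2).
Definition deriv_r (i : 'I_d) t := (t.1.1 * (t.2 i)%:R, t.1.2, decr i t.2).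

Definition bideriv (al be : midx d) t :=
  foldr (fun i => iter (al i) (deriv_l i))
    (foldr (fun i => iter (be i) (deriv_r i)) t (enum 'I_d)) (enum 'I_d).

Lemma is_derive_bieval_l s i x y :
  is_derive x (delta_mx 0 i) (fun z => bieval s z y)
    (bieval [seq deriv_l i t | t <- s] x y).
Proof.
rewrite /bieval big_map.
apply: (@is_derive_seq_sum _ _ _ s (fun t z => biterm t z y)) => t.
have dt := is_deriveZ (t.1.1 * monomial t.2 y) (is_derive_monomial t.1.2 i x).
rewrite (_ : (fun z => biterm t z y) =
  (t.1.1 * monomial t.2 y) *: (monomial t.1.2 : 'rV[R]_d -> R)); last first.
  by apply/funext => z; rewrite fctE /biterm /= mulrAC.
apply: is_derive_eq dt _; rewrite /biterm /deriv_l /= /GRing.scale /=; ring.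
Qed.

Lemma is_derive_bieval_r s i x y :
  is_derive y (delta_mx 0 i) (fun z => bieval s x z)
    (bieval [seq deriv_r i t | t <- s] x y).
Proof.
rewrite /bieval big_map.
apply: (@is_derive_seq_sum _ _ _ s (fun t z => biterm t x z)) => t.
have dt := is_deriveZ (t.1.1 * monomial t.1.2 x) (is_derive_monomial t.2 i y).
rewrite (_ : (fun z => biterm t x z) =
  (t.1.1 * monomial t.1.2 x) *: (monomial t.2 : 'rV[R]_d -> R)); last first.
  by apply/funext => z; rewrite fctE.
apply: is_derive_eq dt _; rewrite /biterm /deriv_r /= /GRing.scale /=; ring.
Qed.

Definition lower (al : midx d) (l : seq 'I_d) (be : midx d) : midx d :=
  [ffun i => (be i - (if i \in l then al i else 0))%N].

Lemma iter_deriv_l n i t : iter n (deriv_l i) t =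
  (t.1.1 * (t.1.2 i ^_ n)%:R, [ffun l => (t.1.2 l - (l == i) * n)%N], t.2).
Proof.
elim: n => [|n IHn] /=.
  rewrite ffactn0 mulr1; case: t => [[c al] be] /=; congr (_, _, _).
  by apply/ffunP => l; rewrite ffunE muln0 subn0.
rewrite IHn /deriv_l /= ffunE eqxx mul1n ffactnSr natrM mulrA; congr (_, _, _).
by apply/ffunP => l; rewrite !ffunE mulnS [in RHS]addnC subnDA.
Qed.

Lemma foldr_deriv_l (al : midx d) l t : uniq l ->
  foldr (fun i => iter (al i) (deriv_l i)) t l =
  (t.1.1 * \prod_(i <- l) (t.1.2 i ^_ al i)%:R, lower al l t.1.2, t.2).
Proof.
elim: l => [_|i l IHl /= /andP[il /IHl ->]] /=.
  rewrite big_nil mulr1; case: t => [[c be] ga]; congr (_, _, _).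
  by apply/ffunP => l; rewrite ffunE subn0.
rewrite iter_deriv_l /= big_cons ffunE (negPf il) subn0.
congr (_, _, _); first by ring.
apply/ffunP => j; rewrite !ffunE in_cons.
by have [->|ji] := eqVneq j i; rewrite ?(negPf il) ?mul1n ?subn0 //= mul0n subn0.
Qed.

Lemma foldr_deriv_r (al : midx d) l t : uniq l ->
  foldr (fun i => iter (al i) (deriv_r i)) t l =
  (t.1.1 * \prod_(i <- l) (t.2 i ^_ al i)%:R, t.1.2, lower al l t.2).
Proof.
move=> l_uniq; pose swap u : R * midx d * midx d := (u.1.1, u.2, u.1.2).
suff -> : foldr (fun i => iter (al i) (deriv_r i)) t l =
    swap (foldr (fun i => iter (al i) (deriv_l i)) (swap t) l).
  by rewrite foldr_deriv_l.
elim: l {l_uniq} => [|i l IHl] /=; first by case: t => [[]].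
by rewrite IHl; elim: (al i) => //= n ->.
Qed.

(** The falling factorial kills the exponents below [al i], and evaluation at 0
    those above. *)
Lemma monomial_deriv_at0 (al be : midx d) :
  \prod_(i <- enum 'I_d) (be i ^_ al i)%:R *
    monomial (lower al (enum 'I_d) be) (0 : 'rV[R]_d) =
  if be == al then (mfact al)%:R else 0.
Proof.
rewrite /monomial /mfact big_enum -big_split /=.
rewrite (eq_bigr (fun i => if be i == al i then (al i)`!%:R else 0)) => [|i _].
  case: eqP => [->|ne].
    by rewrite natr_prod; apply: eq_bigr => i _; rewrite eqxx.
  have [i ne_i] : exists i, be i != al i.
    apply/existsP; apply: contra_notT ne; rewrite negb_exists => /forallP eqi.
    by apply/ffunP => i; have := eqi i; rewrite negbK => /eqP.
  by rewrite (bigD1 i) //= (negPf ne_i) mul0r.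
rewrite mxE ffunE mem_enum; case: ltngtP => [lt_i|gt_i|->].
- by rewrite ffact_small ?mul0r.
- by rewrite expr0n subn_eq0 leqNgt gt_i mulr0.
- by rewrite subnn mulr1 ffactnn.
Qed.

Lemma bieval_bideriv_at0 s (al be : midx d) :
  bieval [seq bideriv al be t | t <- s] 0 0 =
    (mfact al)%:R * (mfact be)%:R * bicoef s al be.
Proof.
rewrite /bieval /bicoef big_map mulr_sumr [RHS]big_mkcond /=.
apply: eq_bigr => t _.
rewrite /biterm /bideriv foldr_deriv_l ?enum_uniq // foldr_deriv_r ?enum_uniq //=.
set A := \prod_(i <- _) _; set B := \prod_(i <- _) _.
rewrite [LHS](_ : _ = t.1.1 * (B * monomial (lower al (enum 'I_d) t.1.2) 0) *
    (A * monomial (lower be (enum 'I_d) t.2) 0)); last by ring.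
rewrite !monomial_deriv_at0.
by case: (t.1.2 == al) (t.2 == be) => [] []; rewrite /= ?mulr0 ?mul0r //; ring.
Qed.

End TwoVariablePolynomials.

(** * Reading the Wronskian off an expansion *)

Section Expansions.
Variables (R : realType) (d N : nat) (rho : R) (h : nat -> R -> R).
Hypotheses (rho_gt0 : 0 < rho) (rho_le1 : rho <= 1).
Hypothesis h_derive : forall j t, 0 < t < rho ->
  is_derive t 1 (h j) (t * h j.+1 t).
Hypothesis h_bound : forall j, exists C, forall t, 0 < t < rho ->
  `|h j t| <= C * (t ^+ N * t^-1 ^+ j.*2).
Implicit Types (K : 'rV[R]_d -> 'rV[R]_d -> R) (s : seq (R * midx d * midx d)).

Definition expansion n K s : Prop :=
  exists2 g : 'rV[R]_d -> R, flat N rho h n g &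
    forall x y, enorm (x - y) < rho -> K x y = bieval s x y + g (x - y).

Lemma enorm_line_lt (x : 'rV[R]_d) (i : 'I_d) : enorm x < rho ->
  \forall t \near (0 : R), enorm (t *: delta_mx 0 i + x) < rho.
Proof.
move=> x_rho; have x_itv : -1 < enorm x < rho.
  by rewrite x_rho andbT (lt_le_trans (ltrN10 R)) ?enorm_ge0.
by near=> t; suff /andP[] : -1 < enorm (t *: delta_mx 0 i + x) < rho by [];
  near: t; exact: enorm_line_near.
Unshelve. all: by end_near.
Qed.

(** The identity holds on an open set, so that it can be differentiated; both
    parts are differentiable, the remainder because its order is at least 2. *)
Lemma expansion_l n K s i :
  expansion n.+2 K s -> expansion n.+1 (partial_l i K) [seq deriv_l i t | t <- s].
Proof.
move=> [g g_flat KE]; exists (fun z => 'D_(delta_mx 0 i) g z).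
  exact: flat_deriv.
move=> x y xy_rho; apply: derive_val; apply: is_derive_line.
have dg := flat_derive rho_le1 h_derive h_bound i g_flat xy_rho.
apply: near_eq_is_derive (is_deriveD
  (is_derive_line_inv (is_derive_bieval_l s i x y)) (is_derive_line_inv dg)).
near=> t; rewrite !fctE addrA -KE // -addrA; near: t; exact: enorm_line_lt.
Unshelve. all: by end_near.
Qed.

Lemma expansion_r n K s i :
  expansion n.+2 K s -> expansion n.+1 (partial_r i K) [seq deriv_r i t | t <- s].
Proof.
move=> [g g_flat KE]; exists (fun z => - 'D_(delta_mx 0 i) g z).
  by apply: flatN; exact: flat_deriv.
move=> x y xy_rho; apply: derive_val; apply: is_derive_line.
have dg := flat_derive rho_le1 h_derive h_bound i g_flat xy_rho.
have dgN : is_derive (0 : R) (1 : R)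
    (fun t : R => g (x - (t *: delta_mx 0 i + y))) (- 'D_(delta_mx 0 i) g (x - y)).
  have dl : is_derive (- 0 : R) (1 : R)
    (fun t : R => g (t *: delta_mx 0 i + (x - y))) ('D_(delta_mx 0 i) g (x - y)).
    by rewrite oppr0; exact: is_derive_line_inv.
  have := is_derive1_comp dl (is_deriveN (is_derive_id (0 : R) 1)).
  rewrite mulrN1; congr is_derive; apply/funext => t /=.
  by rewrite ?fctE scaleNr opprD addrCA.
apply: near_eq_is_derive (is_deriveD
  (is_derive_line_inv (is_derive_bieval_r s i x y)) dgN).
near=> t; rewrite !fctE -KE //.
have -> : x - (t *: delta_mx 0 i + y) = - (t *: delta_mx 0 i + (y - x)).
  by rewrite !opprD opprK addrCA [- y + x]addrC.
rewrite enormN; near: t; apply: enorm_line_lt.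
by rewrite -opprB enormN.
Unshelve. all: by end_near.
Qed.

(** The left and right derivatives iterate in the same way: [P] is the operator on
    kernels, [D] the corresponding operation on terms. *)
Lemma expansion_foldr
    (P : 'I_d -> ('rV[R]_d -> 'rV[R]_d -> R) -> 'rV[R]_d -> 'rV[R]_d -> R)
    (D : 'I_d -> R * midx d * midx d -> R * midx d * midx d) (al : midx d) l n K s :
  (forall i n K s, expansion n.+2 K s -> expansion n.+1 (P i K) (map (D i) s)) ->
  expansion (\sum_(i <- l) al i + n.+1) K s ->
  expansion n.+1 (foldr (fun i => iter (al i) (P i)) K l)
    [seq foldr (fun i => iter (al i) (D i)) t l | t <- s].
Proof.
move=> PD; elim: l n => [|i l IHl] n /=.
  by rewrite big_nil add0n map_id.
rewrite big_cons -addnA addnCA addnS => /IHl.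
elim: (al i) n => [|m IHm] n //; rewrite addSnnS => /IHm/(PD i).
by rewrite -map_comp.
Qed.

Lemma expansion_mpartial n K s (al be : midx d) :
  expansion (mdegree al + mdegree be + n.+1) K s ->
  expansion n.+1 (mpartial al be K) [seq bideriv al be t | t <- s].
Proof.
move=> Ks.
have -> : [seq bideriv al be t | t <- s] =
    [seq foldr (fun i => iter (al i) (@deriv_l R d i)) t (enum 'I_d) | t <-
      [seq foldr (fun i => iter (be i) (@deriv_r R d i)) t (enum 'I_d) | t <- s]].
  by rewrite -map_comp.
apply: (@expansion_foldr (@partial_l R d)) => [i n' K' s'|].
  exact: expansion_l.
rewrite addnS; apply: (@expansion_foldr (@partial_r R d)) => [i n' K' s'|].
  exact: expansion_r.
move: Ks; rewrite /mdegree !big_enum /= addnS addnS addnA.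
by rewrite [(_ + \sum_(i < d) be i)%N]addnC.
Qed.

(** After [|al| + |be|] derivatives the remainder still has positive order, hence
    vanishes at 0. *)
Lemma wronskian_entry_expansion K s (al be : midx d) :
  expansion (mdegree al + mdegree be).+1 K s ->
  wronskian_entry K al be = bicoef s al be.
Proof.
rewrite -addn1 => /expansion_mpartial[g [g0 _] KE].
rewrite /wronskian_entry KE ?subr0 ?enorm0 // g0 addr0 bieval_bideriv_at0.
have fact_neq0 (ga : midx d) : (mfact ga)%:R != 0 :> R.
  by rewrite pnatr_eq0 -lt0n prodn_gt0 // => i; exact: fact_gt0.
by rewrite mulrC mulKf // mulf_neq0.
Qed.

End Expansions.

(** * Expansion of a stationary kernel *)

Section PolynomialKernels.
Variables (R : realType) (d : nat).
Implicit Types (F G : 'rV[R]_d -> 'rV[R]_d -> R) (s : seq (R * midx d * midx d)).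

Definition degree_le D s : bool :=
  all (fun t => mdegree t.1.2 + mdegree t.2 <= D)%N s.

Definition bipoly D F : Prop :=
  exists2 s, degree_le D s & forall x y, F x y = bieval s x y.

Lemma bipoly_ext D F G : (forall x y, F x y = G x y) -> bipoly D F -> bipoly D G.
Proof. by move=> FG [s s_D sF]; exists s => // x y; rewrite -FG. Qed.

Lemma bipoly_add D F G :
  bipoly D F -> bipoly D G -> bipoly D (fun x y => F x y + G x y).
Proof.
move=> [s s_D sF] [s' s'_D s'G]; exists (s ++ s').
  by rewrite /degree_le all_cat; apply/andP.
by move=> x y; rewrite sF s'G /bieval big_cat.
Qed.

Definition madd (al be : midx d) : midx d := [ffun i => (al i + be i)%N].

Lemma monomial_madd al be (x : 'rV[R]_d) :
  monomial (madd al be) x = monomial al x * monomial be x.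
Proof. by rewrite /monomial -big_split; apply: eq_bigr => i _; rewrite ffunE exprD. Qed.

Lemma mdegree_madd (al be : midx d) :
  mdegree (madd al be) = (mdegree al + mdegree be)%N.
Proof. by rewrite /mdegree -big_split; apply: eq_bigr => i _; rewrite ffunE. Qed.

Lemma bipoly_mul D E F G :
  bipoly D F -> bipoly E G -> bipoly (D + E) (fun x y => F x y * G x y).
Proof.
move=> [s s_D sF] [s' s'_E s'G].
exists [seq (t.1.1 * u.1.1, madd t.1.2 u.1.2, madd t.2 u.2) | t <- s, u <- s'].
  apply/all_allpairsP => t u ts us /=; rewrite !mdegree_madd addnACA.
  by apply: leq_add; [apply: (allP s_D) | apply: (allP s'_E)].
move=> x y; rewrite sF s'G /bieval big_distrlr /= big_allpairs_dep.
apply: eq_bigr => t _; apply: eq_bigr => u _.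
by rewrite /biterm /= !monomial_madd; ring.
Qed.

Definition mzero : midx d := [ffun=> 0%N].
Definition munit (i : 'I_d) : midx d := [ffun l => (l == i : nat)].

Lemma monomial_mzero (x : 'rV[R]_d) : monomial mzero x = 1.
Proof. by rewrite /monomial big1 // => i _; rewrite ffunE. Qed.

Lemma mdegree_mzero : mdegree mzero = 0%N.
Proof. by rewrite /mdegree big1 // => i _; rewrite ffunE. Qed.

Lemma monomial_munit i (x : 'rV[R]_d) : monomial (munit i) x = x 0 i.
Proof.
rewrite /monomial (bigD1 i) //= ffunE eqxx expr1 big1 ?mulr1 // => l li.
by rewrite ffunE (negPf li).
Qed.

Lemma mdegree_munit i : mdegree (munit i) = 1%N.
Proof.
rewrite /mdegree (bigD1 i) //= ffunE eqxx big1 // => l li.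
by rewrite ffunE (negPf li).
Qed.

Lemma bipoly_cst D (a : R) : bipoly D (fun _ _ => a).
Proof.
exists [:: (a, mzero, mzero)]; first by rewrite /degree_le /= !mdegree_mzero.
by move=> x y; rewrite /bieval big_seq1 /biterm /= !monomial_mzero !mulr1.
Qed.

Lemma bipoly_sum (I : Type) (r : seq I) (P : pred I) D
    (F : I -> 'rV[R]_d -> 'rV[R]_d -> R) :
  (forall i, P i -> bipoly D (F i)) ->
  bipoly D (fun x y => \sum_(i <- r | P i) F i x y).
Proof.
move=> FD; elim: r => [|i r IHr].
  by apply: bipoly_ext (bipoly_cst D 0) => x y; rewrite big_nil.
have [Pi|Pi] := boolP (P i).
  apply: bipoly_ext (bipoly_add (FD i Pi) IHr) => x y.
  by rewrite big_cons Pi.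
by apply: bipoly_ext IHr => x y; rewrite big_cons (negPf Pi).
Qed.

(** The square root disappears in even degree. *)
Lemma bipoly_enorm_even D l : (l.*2 <= D)%N ->
  bipoly D (fun x y => enorm (x - y) ^+ l.*2).
Proof.
have sqr2 : bipoly 2 (fun x y => enorm (x - y) ^+ 2).
  apply: (@bipoly_ext _ (fun x y => \sum_(i < d) (x - y) 0 i ^+ 2)) => [x y|].
    by rewrite /enorm sqr_sqrtr // sumr_ge0 // => i _; exact: sqr_ge0.
  apply: bipoly_sum => i _.
  have lin : bipoly 1 (fun x y => (x - y) 0 i).
    exists [:: (1, munit i, mzero); (-1, mzero, munit i)].
      by rewrite /degree_le /= !mdegree_munit !mdegree_mzero.
    move=> x y; rewrite /bieval !big_cons big_nil /biterm /=.
    by rewrite !monomial_munit !monomial_mzero !mxE; ring.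
  apply: bipoly_ext (bipoly_mul lin lin) => x y.
  by rewrite expr2.
move=> lD; have [s s_l sE] : bipoly l.*2 (fun x y => enorm (x - y) ^+ l.*2).
  elim: l {lD} => [|l IHl].
    by apply: bipoly_ext (bipoly_cst 0 1) => x y; rewrite expr0.
  rewrite doubleS -add2n; apply: bipoly_ext (bipoly_mul sqr2 IHl) => x y.
  by rewrite exprD.
by exists s => //; apply: sub_all s_l => t /leq_trans; apply.
Qed.

(** Averaging the list of terms with its mirror image avoids the question of the
    uniqueness of coefficients. *)
Lemma bieval_symmetrize D F : bipoly D F -> (forall x y, F x y = F y x) ->
  exists s, [/\ degree_le D s, forall x y, F x y = bieval s x y
              & forall al be, bicoef s al be = bicoef s be al].
Proof.
move=> [s s_D sF] symF.
exists ([seq (t.1.1 / 2, t.1.2, t.2) | t <- s] ++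
        [seq (t.1.1 / 2, t.2, t.1.2) | t <- s]).
split.
- rewrite /degree_le all_cat !all_map; apply/andP; split; apply: sub_all s_D => t //=.
  by rewrite addnC.
- move=> x y; rewrite /bieval big_cat !big_map /=.
  rewrite (_ : F x y = (F x y + F y x) / 2); last by rewrite -(symF x y); field.
  rewrite !sF /bieval -big_split mulr_suml -big_split /=; apply: eq_bigr => t _.
  by rewrite /biterm /=; ring.
- move=> al be; rewrite /bicoef !big_cat !big_map /= addrC.
  by congr (_ + _); apply: eq_bigl => t; rewrite andbC.
Qed.

End PolynomialKernels.

Lemma smoothness_order_odd (R : realType) (c : R^nat) r k i :
  smoothness_order c r -> lt_order k r -> (i < k.*2.+1)%N -> odd i -> c i = 0.
Proof.
move=> rP kr ik oi; have E : i = (2 * (i./2).+1 - 1)%N.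
  by have := odd_double_half i; rewrite oi -mul2n; lia.
have lt_ik : ((i./2).+1 <= k)%N by move: ik; rewrite -mul2n; lia.
rewrite E; case: r rP kr => [r [_ _ rP] kr|rP _]; last exact: rP.
by apply: rP; rewrite /= (leq_ltn_trans lt_ik).
Qed.

Lemma analytic_at0_psum (R : realType) (f : R -> R) (c : R^nat) :
  analytic_at0 f c -> exists2 tau : R, 0 < tau &
    cvg_inside tau c /\ forall t, `|t| < tau -> f t = psum c t.
Proof.
move=> /nbhs_ballP[tau /= tau_gt0 fc]; exists tau => //.
have {}fc t : `|t| < tau -> pseries c t @ \oo --> f t.
  by move=> t_tau; apply: fc; rewrite /ball /= sub0r normrN.
by split=> t /fc ft; [exact: cvgP ft | apply/esym/cvg_lim].
Qed.

(** The Taylor polynomial of [f] of degree [2k] gives the polynomial part, and the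
    tail of the series, [t^(2k+1)] times a power series, gives the flat part.  The
    list [s] carries all that is needed of the Wronskian: its entries, their
    symmetry, and the approximation of the kernel. *)
Lemma kernel_expansion (R : realType) d (kappa : 'rV[R]_d -> 'rV[R]_d -> R)
    (f : R -> R) (c : R^nat) r k :
  stationary kappa f -> analytic_at0 f c -> smoothness_order c r -> lt_order k r ->
  exists s : seq (R * midx d * midx d),
    [/\ degree_le k.*2 s,
        forall al be, bicoef s al be = bicoef s be al,
        forall al be, (mdegree al + mdegree be <= k.*2)%N ->
          wronskian_entry kappa al be = bicoef s al be
      & exists C rho : R, 0 < rho /\ forall x y, enorm (x - y) < rho ->
          `|kappa x y - bieval s x y| <= C * enorm (x - y) ^+ k.*2.+1].
Proof.
move=> kf /analytic_at0_psum[tau tau_gt0 [c_cvg fE]] rP kr.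
pose N := k.*2.+1; pose a : R^nat := fun i => c (i + N)%N.
have a_cvg : cvg_inside tau a by exact: cvg_inside_shift.
pose rho := Num.min (tau / 2) 1.
have rho_gt0 : 0 < rho by rewrite lt_min ltr01 divr_gt0.
have rho_le1 : rho <= 1 by rewrite ge_min lexx orbT.
have rho_tau : rho < tau.
  by rewrite gt_min ltr_pdivrMr // ltr_pMr // ltr1n.
pose h := radial N a.
have h_derive j t : 0 < t < rho -> is_derive t 1 (h j) (t * h j.+1 t).
  move=> /andP[t0 t_rho]; apply: (is_derive_radial N tau_gt0 a_cvg).
  by rewrite t0 (lt_trans t_rho).
have h_bound j : exists C, forall t, 0 < t < rho ->
    `|h j t| <= C * (t ^+ N * t^-1 ^+ j.*2).
  have rho_itv : 0 <= rho < tau by rewrite ltW.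
  have [C Cb] := radial_bounded N tau_gt0 a_cvg j rho_itv.
  by exists C => t /andP[t0 t_rho]; apply: Cb; rewrite t0 ltW.
pose F (x y : 'rV[R]_d) := \sum_(i < N) c i * enorm (x - y) ^+ i.
have F_poly : bipoly k.*2 F.
  apply: bipoly_sum => i _.
  have [oi|ei] := boolP (odd i).
    apply: (bipoly_ext _ (@bipoly_cst R d k.*2 0)) => x y.
    by rewrite (smoothness_order_odd rP kr (ltn_ord i) oi) mul0r.
  rewrite -[k.*2]add0n.
  apply: (@bipoly_mul _ _ 0 _ (fun _ _ => c i) (fun x y => enorm (x - y) ^+ i)).
    exact: bipoly_cst.
  have iE : nat_of_ord i = (i./2).*2.
    by rewrite -[LHS]odd_double_half (negPf ei).
  rewrite iE; apply: bipoly_enorm_even; rewrite -iE; have := ltn_ord i.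
  by rewrite ltnS.
have [s [s_D sF s_sym]] : exists s, [/\ degree_le k.*2 s,
    forall x y, F x y = bieval s x y
    & forall al be, bicoef s al be = bicoef s be al].
  apply: bieval_symmetrize => // x y; apply: eq_bigr => i _.
  by rewrite -opprB enormN.
pose g (z : 'rV[R]_d) := h 0%N (enorm z).
have g_flat : flat N rho h N g.
  split; first by rewrite /g /h /radial enorm0 expr0n !mul0r.
  exists [:: (1, @mzero d, 0%N)].
    by rewrite /= /term_order /= addn0 leq_addl implybT.
  by move=> z _; rewrite big_seq1 /radial_term /= monomial_mzero !mul1r.
have KE x y : enorm (x - y) < rho -> kappa x y = bieval s x y + g (x - y).
  move=> xy; have t_tau : `|enorm (x - y)| < tau.
    by rewrite ger0_norm ?enorm_ge0 // (lt_trans xy).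
  rewrite kf fE // (psum_shift tau_gt0 N c_cvg) // -sF; congr (_ + _).
  by rewrite /g /h /radial /= expr0 mulr1.
exists s; split=> //.
  move=> al be ab; apply: (@wronskian_entry_expansion _ _ N rho h) => //.
  exists g => //; have [g0 [u u_N gE]] := g_flat; split=> //; exists u => //.
  apply: sub_all u_N => v; rewrite /term_order => /implyP vN; apply/implyP => /vN.
  by apply: leq_trans; rewrite leq_add2r.
have [C C_ge0 Cb] := flat_bound rho_le1 h_bound g_flat.
exists C, rho; split=> // x y xy; rewrite KE // addrC addKr; exact: Cb.
Qed.

(** * Splitting by degree *)

(** The cross terms [G The V^T] and their transposes are absorbed into the square
    at the price of [- G W^-1 G^T], which is of the order of the corner [A]. *)
Lemma complete_square (F : fieldType) n p (A : 'M[F]_n) (V G : 'M[F]_(n, p))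
    (W Gam The : 'M[F]_p) :
  W \in unitmx -> W^T = W -> Gam^T = Gam -> The^T = The -> Gam *m The = 1%:M ->
  let Y := V + G *m invmx W *m Gam in
  A - G *m invmx W *m G^T + Y *m (The *m W *m The) *m Y^T =
  V *m The *m W *m The *m V^T + G *m The *m V^T + V *m The *m G^T + A.
Proof.
move=> uW symW symGam symThe GT Y.
have TG : The *m Gam = 1%:M by exact: mulmx1C.
have YT : Y *m The = V *m The + G *m invmx W.
  by rewrite mulmxDl -(mulmxA _ Gam) GT mulmx1.
have -> : Y *m (The *m W *m The) *m Y^T = (Y *m The) *m W *m (Y *m The)^T.
  by rewrite trmx_mul symThe !mulmxA.
rewrite YT linearD /= !trmx_mul trmx_inv symW symThe mulmxDl mulmxDr !mulmxDl.
have -> : G *m invmx W *m W = G by rewrite -mulmxA mulVmx // mulmx1.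
have -> : V *m The *m W *m (invmx W *m G^T) = V *m The *m G^T.
  by rewrite -!mulmxA (mulmxA W) mulmxV // mul1mx.
rewrite !mulmxA; set a := V *m The *m W *m The *m V^T.
set b := G *m The *m V^T; set c := V *m The *m G^T; set e := _ *m G^T.
move: a b c e => a b c e; apply/matrixP => i j; rewrite !mxE; ring.
Qed.

Lemma invmx_congr (F : fieldType) p (W Gam The : 'M[F]_p) :
  W \in unitmx -> Gam *m The = 1%:M ->
  The *m W *m The \in unitmx /\ invmx (The *m W *m The) = Gam *m invmx W *m Gam.
Proof.
move=> uW GT; have TG : The *m Gam = 1%:M by exact: mulmx1C.
have MN : The *m W *m The *m (Gam *m invmx W *m Gam) = 1%:M.
  by rewrite !mulmxA -(mulmxA _ The) TG mulmx1 -(mulmxA _ W) mulmxV // mulmx1.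
have [uM _] := mulmx1_unit MN; split=> //.
have := congr1 (mulmx (invmx (The *m W *m The))) MN.
by rewrite mulKmx // mulmx1.
Qed.

(** The blocks [V i], [B i j] stand for the monomials and the Wronskian
    coefficients of given degrees.  The sum of the terms of degrees [(i, j)] is cut
    at [k] in both indices: the corner [i, j < k] gives the square, the corner
    [i, j >= k] reduces to [i = j = k] since higher blocks vanish, and the two
    other corners give the cross terms. *)
Section BlockSplit.
Variables (F : fieldType) (n k : nat) (q : nat -> nat).
Variables (V : forall i, 'M[F]_(n, q i)) (B : forall i j, 'M[F]_(q i, q j)).
Hypothesis B_sym : forall i j, (B i j)^T = B j i.
Hypothesis B_high : forall i j, (k.*2 < i + j)%N -> B i j = 0.

Definition low_rows : 'M[F]_(n, \sum_(i < k) q i) := \mxrow_(i < k) V i.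
Definition low_block : 'M[F]_(\sum_(i < k) q i) := \mxblock_(i < k, j < k) B i j.
Definition degree_diag (a : nat -> F) : 'M[F]_(\sum_(i < k) q i) :=
  \mxdiag_(i < k) (a i)%:M.
(** The contribution of the degrees [k] to [2k] in the first variable, divided by
    [eps^k].  With the index [i + k], rather than [k + i], the term [i = 0] has
    degree [k] by computation. *)
Definition high_part (eps : F) : 'M[F]_(n, \sum_(i < k) q i) :=
  \mxrow_(j < k) \sum_(i < k.+1) eps ^+ i *: (V (i + k)%N *m B (i + k)%N j).

Lemma degree_diagE a u v : degree_diag a u v = a (tagnat.sig1 u) *+ (u == v).
Proof.
have -> : degree_diag a = diag_mx (\mxrow_(i < k) const_mx (a i)).
  by rewrite diag_mxrow; apply: eq_mxdiag => i; rewrite diag_const_mx.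
by rewrite !mxE; case: eqVneq => // ->.
Qed.

Lemma tr_degree_diag a : (degree_diag a)^T = degree_diag a.
Proof.
rewrite /degree_diag tr_mxdiag; apply: eq_mxdiag => i; exact: tr_scalar_mx.
Qed.

Lemma degree_diag_mul a b : (forall i, (i < k)%N -> a i * b i = 1) ->
  degree_diag a *m degree_diag b = 1%:M.
Proof.
move=> ab; apply/matrixP => u v; rewrite mxE (bigD1 u) //=.
rewrite [X in _ + X]big1 ?addr0 => [|w wu].
  rewrite !degree_diagE eqxx mulr1n !mxE mulrnAr ab //.
by rewrite degree_diagE eq_sym (negPf wu) mul0r.
Qed.

Definition block_term (eps : F) i j : 'M[F]_n :=
  eps ^+ (i + j) *: (V i *m B i j *m (V j)^T).

Lemma tr_block_term eps i j : (block_term eps i j)^T = block_term eps j i.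
Proof. by rewrite linearZ /= !trmx_mul trmxK B_sym mulmxA addnC. Qed.

(* The inverse of the diagonal matrix of the [eps^(k-i)]. *)
Let The eps := degree_diag (fun i => eps ^- (k - i)).

Lemma low_rows_diag eps :
  low_rows *m The eps = \mxrow_(i < k) (eps ^- (k - i) *: V i).
Proof.
by rewrite mul_mxrow_mxdiag; apply: eq_mxrow => i; rewrite mul_mx_scalar.
Qed.

Lemma block_term_scale eps i j : eps != 0 -> (i < k)%N -> (j < k)%N ->
  eps ^- k.*2 *: block_term eps i j =
  (eps ^- (k - i) *: (V i *m B i j)) *m (eps ^- (k - j) *: V j)^T.
Proof.
move=> eps0 ik jk.
have -> : (eps ^- (k - j) *: V j)^T = eps ^- (k - j) *: (V j)^T by rewrite linearZ.
rewrite -scalemxAl -scalemxAr !scalerA.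
congr (_ *: _); rewrite -invfM -exprD.
have -> : k.*2 = ((k - i + (k - j)) + (i + j))%N by lia.
by rewrite exprD invfM mulfVK // expf_neq0.
Qed.

Lemma low_low_part eps : eps != 0 ->
  eps ^- k.*2 *: (\sum_(i < k) \sum_(j < k) block_term eps i j) =
  low_rows *m The eps *m low_block *m The eps *m low_rows^T.
Proof.
move=> eps0; have TT : The eps = (The eps)^T by rewrite tr_degree_diag.
rewrite -(mulmxA _ (The eps)) {2}TT -trmx_mul.
rewrite low_rows_diag tr_mxrow mul_mxrow_mxblock mul_mxrow_mxcol exchange_big /=.
rewrite scaler_sumr; apply: eq_bigr => j _; rewrite mulmx_suml scaler_sumr.
by apply: eq_bigr => i _; rewrite block_term_scale // scalemxAl.
Qed.

Lemma high_low_part eps : eps != 0 ->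
  eps ^- k.*2 *: (\sum_(i < k.+1) \sum_(j < k) block_term eps (i + k) j) =
  high_part eps *m The eps *m low_rows^T.
Proof.
move=> eps0; have TT : The eps = (The eps)^T by rewrite tr_degree_diag.
rewrite -mulmxA TT -trmx_mul.
rewrite low_rows_diag tr_mxrow mul_mxrow_mxcol exchange_big /=.
rewrite scaler_sumr; apply: eq_bigr => j _; rewrite mulmx_suml scaler_sumr.
apply: eq_bigr => i _.
have -> : (eps ^- (k - j) *: V j)^T = eps ^- (k - j) *: (V j)^T by rewrite linearZ.
rewrite -scalemxAl -scalemxAr !scalerA.
congr (_ *: _); have jk := ltn_ord j.
have -> : k.*2 = (k + (k - j) + j)%N by lia.
rewrite !exprD !invfM [RHS]mulrC mulrACA -[RHS]mulr1; congr (_ * _).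
  by field; rewrite !expf_neq0.
by rewrite mulVf // expf_neq0.
Qed.

Lemma block_split eps : eps != 0 ->
  eps ^- k.*2 *: (\sum_(i < k.*2.+1) \sum_(j < k.*2.+1) block_term eps i j) =
  low_rows *m The eps *m low_block *m The eps *m low_rows^T
  + high_part eps *m The eps *m low_rows^T
  + low_rows *m The eps *m (high_part eps)^T
  + V k *m B k k *m (V k)^T.
Proof.
move=> eps0.
have split_sum (T : nat -> 'M[F]_n) : \sum_(i < k.*2.+1) T i =
    \sum_(i < k) T i + \sum_(i < k.+1) T (i + k)%N.
  rewrite -addnn -addnS big_split_ord /=; congr (_ + _).
  by apply: eq_bigr => i _; rewrite addnC.
rewrite (split_sum (fun i => \sum_(j < k.*2.+1) block_term eps i j)).
under eq_bigr do rewrite split_sum.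
under [X in _ + X]eq_bigr do rewrite split_sum.
rewrite !big_split /= !scalerDr low_low_part // high_low_part //.
have -> : eps ^- k.*2 *: (\sum_(i < k) \sum_(j < k.+1) block_term eps i (j + k)) =
    low_rows *m The eps *m (high_part eps)^T.
  apply: trmx_inj; rewrite !trmx_mul trmxK tr_degree_diag mulmxA -high_low_part //.
  rewrite linearZ /=; congr (_ *: _); rewrite exchange_big linear_sum /=.
  apply: eq_bigr => j _; rewrite linear_sum; apply: eq_bigr => i _.
  exact: tr_block_term.
have -> : \sum_(i < k.+1) \sum_(j < k.+1) block_term eps (i + k) (j + k) =
    block_term eps k k.
  have T0 (i j : 'I_k.+1) : (0 < i + j)%N -> block_term eps (i + k) (j + k) = 0.
    by move=> ij; rewrite /block_term B_high ?mulmx0 ?mul0mx ?scaler0 //; lia.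
  rewrite (bigD1 ord0) //= (bigD1 ord0) //= big1 ?addr0 => [|j j0]; last first.
    by apply: (T0 ord0 j); move: j0; rewrite -val_eqE /=; lia.
  rewrite big1 ?addr0 // => i i0; apply: big1 => j _.
  by apply: (T0 i j); move: i0; rewrite -val_eqE /=; lia.
rewrite /block_term scalerA addnn mulVf ?expf_neq0 // scale1r.
by rewrite !addrA; congr (_ + _); rewrite addrAC.
Qed.

End BlockSplit.

(** * The polynomial part as a sum of blocks *)

Section MonomialBlocks.
Variables (R : realType) (d : nat) (e : forall i, 'I_(nmono d i) -> midx d).
Hypothesis e_enum : midx_enum e.
Implicit Types (s : seq (R * midx d * midx d)).

Lemma monomialZ (al : midx d) (t : R) (x : 'rV[R]_d) :
  monomial al (t *: x) = t ^+ mdegree al * monomial al x.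
Proof.
rewrite /monomial /mdegree -prodrXr -big_split; apply: eq_bigr => i _.
by rewrite mxE exprMn.
Qed.

Lemma mdegree_enum i (a : 'I_(nmono d i)) : mdegree (e a) = i.
Proof. by have [_ eP] := e_enum i; apply/eP; exists a. Qed.

(** The enumerations [e i], for [i <= D], list each multi-index of degree at most
    [D] exactly once. *)
Lemma sum_midx_enum D (al : midx d) (phi : R) : (mdegree al <= D)%N ->
  \sum_(i < D.+1) \sum_(a < nmono d i) (if al == e a then phi else 0) = phi.
Proof.
move=> al_D; rewrite -ltnS in al_D.
have [e_inj eP] := e_enum (mdegree al); have [b eb] := (eP al).1 erefl.
rewrite (bigD1 (Ordinal al_D)) //= [X in _ + X]big1 ?addr0 => [|i i_al].
  rewrite (bigD1 b) //= eb eqxx big1 ?addr0 // => a ab.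
  by case: eqP => // ea; case/eqP: ab; apply: e_inj; rewrite eb.
apply: big1 => a _; case: eqP => // al_e; case/eqP: i_al.
by apply: val_inj; rewrite /= al_e mdegree_enum.
Qed.

Definition coef_block s i j : 'M[R]_(nmono d i, nmono d j) :=
  \matrix_(a, b) bicoef s (e a) (e b).

Lemma tr_coef_block s i j : (forall al be, bicoef s al be = bicoef s be al) ->
  (coef_block s i j)^T = coef_block s j i.
Proof. by move=> s_sym; apply/matrixP => a b; rewrite !mxE. Qed.

Lemma coef_block_high D s i j :
  degree_le D s -> (D < i + j)%N -> coef_block s i j = 0.
Proof.
move=> s_D ij; apply/matrixP => a b; rewrite !mxE /bicoef big_seq_cond big1 // => t.
move=> /and3P[ts /eqP ta /eqP tb]; have := allP s_D t ts.
by rewrite ta tb !mdegree_enum leqNgt ij.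
Qed.

(** Each term of [s] is counted once, at the position of its two multi-indices;
    the factor [eps^(i+j)] comes from homogeneity. *)
Lemma bieval_blocks D s n (x : 'I_n -> 'rV[R]_d) (eps : R) l l' :
  degree_le D s ->
  bieval s (eps *: x l) (eps *: x l') =
  (\sum_(i < D.+1) \sum_(j < D.+1)
     block_term (vandermonde_deg e x) (coef_block s) eps i j) l l'.
Proof.
move=> s_D; transitivity (\sum_(i < D.+1) \sum_(j < D.+1)
    \sum_(b < nmono d j) \sum_(a < nmono d i)
      bicoef s (e a) (e b) *
        (monomial (e a) (eps *: x l) * monomial (e b) (eps *: x l')));
  last first.
  rewrite summxE; apply: eq_bigr => i _; rewrite summxE; apply: eq_bigr => j _.
  rewrite /block_term !mxE mulr_sumr; apply: eq_bigr => b _.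
  rewrite !mxE mulr_suml mulr_sumr; apply: eq_bigr => a _.
  by rewrite !mxE !monomialZ !mdegree_enum exprD; ring.
transitivity (\sum_(t <- s) \sum_(i < D.+1) \sum_(a < nmono d i)
    (if t.1.2 == e a then \sum_(j < D.+1) \sum_(b < nmono d j)
    (if t.2 == e b then biterm t (eps *: x l) (eps *: x l') else 0) else 0)).
  rewrite /bieval; apply: eq_big_seq => t /(allP s_D) t_D.
  rewrite sum_midx_enum; last exact: leq_trans (leq_addl _ _) t_D.
  by rewrite sum_midx_enum //; exact: leq_trans (leq_addr _ _) t_D.
rewrite exchange_big; apply: eq_bigr => i _ /=.
under [RHS]eq_bigr do rewrite exchange_big.
rewrite [RHS]exchange_big /= exchange_big; apply: eq_bigr => a _ /=.
rewrite (eq_bigr (fun t => \sum_(j < D.+1) \sum_(b < nmono d j)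
  if (t.1.2 == e a) && (t.2 == e b) then biterm t (eps *: x l) (eps *: x l') else 0)).
  rewrite exchange_big; apply: eq_bigr => j _ /=.
  rewrite exchange_big; apply: eq_bigr => b _ /=.
  rewrite -big_mkcond /bicoef mulr_suml; apply: eq_bigr => t /andP[/eqP ta /eqP tb].
  by rewrite /biterm ta tb mulrA.
move=> t _; case: eqP => //= _; rewrite big1 // => j _; exact: big1.
Qed.

End MonomialBlocks.

(** * Limits of the blocks *)

Section RightLimits.
Variable R : realType.

Lemma mxcvg_near m n (A A' : R -> 'M[R]_(m, n)) L :
  (forall eps : R, 0 < eps -> A eps = A' eps) ->
  mxcvg 0^'+ A' L -> mxcvg 0^'+ A L.
Proof.
move=> AA' AL i j; apply: cvg_trans (AL i j); apply: near_eq_cvg.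
by near=> eps; rewrite AA'.
Unshelve. all: by end_near.
Qed.

Lemma cvg_expr_right i : (eps : R) ^+ i @[eps --> 0^'+] --> ((i == 0%N)%:R : R).
Proof.
rewrite -expr0n; apply: cvg_at_right_filter; exact: exprn_continuous.
Qed.

Lemma mxcvg_mxrow m k (q : 'I_k -> nat) (A : forall j, R -> 'M[R]_(m, q j)) L :
  (forall j, mxcvg 0^'+ (A j) (L j)) ->
  mxcvg 0^'+ (fun eps => \mxrow_j A j eps) (\mxrow_j L j).
Proof. by move=> AL i j; rewrite mxE; under eq_cvg do rewrite mxE; exact: AL. Qed.

Lemma cvg_right_linear (g : R -> R) (C delta : R) : 0 < delta ->
  (forall eps, 0 < eps < delta -> `|g eps| <= C * eps) -> g eps @[eps --> 0^'+] --> 0.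
Proof.
move=> delta_gt0 gC; apply/cvgr0Pnorm_lt => a a_gt0; near=> eps.
have e_gt0 : 0 < eps by [].
have e_delta : eps < delta by near: eps; exact: nbhs_right_lt.
have e_small : eps < a / (`|C| + 1).
  by near: eps; apply: nbhs_right_lt; rewrite divr_gt0 // ltr_wpDl.
apply: le_lt_trans (gC _ _) _; first by rewrite e_gt0.
apply: le_lt_trans (_ : (`|C| + 1) * eps < _).
  apply: ler_wpM2r; first exact: ltW.
  by apply: le_trans (ler_norm _) _; rewrite lerDl.
by rewrite mulrC -ltr_pdivlMr // ltr_wpDl.
Unshelve. all: by end_near.
Qed.

Lemma cvg_high_part n k (q : nat -> nat) (V : forall i, 'M[R]_(n, q i))
    (B : forall i j, 'M[R]_(q i, q j)) :
  mxcvg 0^'+ (high_part k V B) (V k *m \mxrow_(j < k) B k j).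
Proof.
rewrite mul_mxrow; apply: mxcvg_mxrow => j.
have -> : V k *m B k j =
    \sum_(i < k.+1) ((i == 0 :> nat)%:R *: (V (i + k)%N *m B (i + k)%N j)).
  rewrite (bigD1 ord0) //= scale1r big1 ?addr0 // => i i0.
  by rewrite -val_eqE /= in i0; rewrite (negPf i0) scale0r.
apply: mxcvg_sum => i _; apply: mxcvg_scale; first exact: cvg_expr_right.
exact: mxcvg_cst.
Qed.

(** The exponents [k - i] are positive since only degrees below [k] occur. *)
Lemma cvg_degree_diag k (q : nat -> nat) :
  mxcvg 0^'+ (fun eps : R => degree_diag k q (fun i => eps ^+ (k - i))) 0.
Proof.
move=> u v; rewrite mxE; under eq_cvg do rewrite degree_diagE.
have lt_uk := ltn_ord (tagnat.sig1 u).
case: (u == v) => /=; last exact: cvg_cst.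
have := @cvg_expr_right (k - tagnat.sig1 u)%N.
by rewrite subn_eq0 leqNgt lt_uk.
Qed.

End RightLimits.

(** * The flat limit *)

Lemma gram_scaled_posdef (R : realType) d n (x : 'I_n -> 'rV[R]_d)
    (kappa : 'rV[R]_d -> 'rV[R]_d -> R) f (eps : R) :
  injective x -> posdef_kernel kappa -> stationary kappa f -> 0 < eps ->
  posdef (gram_matrix (scaled_kernel f eps) x).
Proof.
move=> x_inj kpd kf e_gt0.
have -> : gram_matrix (scaled_kernel f eps) x =
    gram_matrix kappa (fun i => eps *: x i).
  by apply/matrixP => i j; rewrite !mxE kf -scalerBr enormZ // ltW.
by apply: kpd => i j /(scalerI (lt0r_neq0 e_gt0))/x_inj.
Qed.

Theorem theorem5p4 (R : realType) (d : nat) (d_gt0 : (0 < d)%N)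
    (n : nat) (x : 'I_n -> 'rV[R]_d) (x_inj : injective x)
    (kappa : 'rV[R]_d -> 'rV[R]_d -> R) (kappa_pd : posdef_kernel kappa)
    (f : R -> R) (kappa_stat : stationary kappa f)
    (c : R^nat) (f_analytic : analytic_at0 f c)
    (r : option nat) (r_order : smoothness_order c r)
    (e : forall i, 'I_(nmono d i) -> midx d) (e_enum : midx_enum e)
    (m : nat) (m_ge1 : (1 <= m)%N) (m_le_n : (m <= n)%N)
    (m_le_r : le_nmono_order d m r)
    (k : nat) (k_lt_r : lt_order k r)
    (m_gt_k : (nmono_lt d k < m)%N) (m_le_k : (m <= nmono_lt d k.+1)%N) :
  let L (eps : R) := gram_matrix (scaled_kernel f eps) x in
  let Vk := vandermonde_deg e x k in
  let Wbar := wronskian_schur e kappa k in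
  let Lstar := Vk *m Wbar *m Vk^T in
  let Vstar := vandermonde_lt e x k in
  wronskian_lt e kappa k \in unitmx ->
  normalizable m (pp_weight Lstar Vstar) ->
  (forall eps : R, 0 < eps -> exists P, Lensemble m (L eps) P) /\
  (exists2 Pstar, ppDPP m Lstar Vstar Pstar &
     forall P : R -> {set 'I_n} -> R,
       (forall eps : R, 0 < eps -> Lensemble m (L eps) (P eps)) ->
       forall X, P eps X @[eps --> 0^'+] --> Pstar X).
Proof.
move=> L Vk Wbar Lstar Vstar.
have L_pd (eps : R) : 0 < eps -> posdef (L eps).
  by move=> e_gt0; exact: (gram_scaled_posdef x_inj kappa_pd kappa_stat).
have [s [s_D s_sym WE [C [rho [rho_gt0 kb]]]]] :=
  kernel_expansion kappa_stat f_analytic r_order k_lt_r.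
pose B := coef_block e s; pose V := vandermonde_deg e x.
have B_sym i j : (B i j)^T = B j i by exact: tr_coef_block.
have B_high i j : (k.*2 < i + j)%N -> B i j = 0 by exact: (coef_block_high e_enum).
have WB i j : (i + j <= k.*2)%N -> wronskian_block e kappa i j = B i j.
  by move=> ij; apply/matrixP => a b; rewrite !mxE WE // !mdegree_enum.
have Wlt : wronskian_lt e kappa k = low_block k B.
  apply: eq_mxblock => i j; apply: WB.
  by have := ltn_ord i; have := ltn_ord j; lia.
have Wll : wronskian_ll e kappa k = \mxrow_(j < k) B k j.
  by apply: eq_mxrow => j; apply: WB; have := ltn_ord j; lia.
have Wur : wronskian_ur e kappa k = (\mxrow_(j < k) B k j)^T.
  rewrite tr_mxrow; apply: eq_mxcol => i; rewrite B_sym; apply: WB.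
  by have := ltn_ord i; lia.
have Wkk : wronskian_block e kappa k k = B k k by apply: WB; rewrite addnn.
set W := low_block k B in Wlt; set Bk := \mxrow_(j < k) B k j in Wll Wur.
rewrite Wlt => W_unit w_norm; split=> [eps /L_pd|]; first exact: Lensemble_posdef.
have symW : W^T = W by rewrite tr_mxblock; apply: eq_mxblock => i j; exact: B_sym.
pose G := high_part k V B.
pose Gam (eps : R) := degree_diag k (nmono d) (fun i => eps ^+ (k - i)).
pose The (eps : R) := degree_diag k (nmono d) (fun i => eps ^- (k - i)).
have GT eps : 0 < eps -> Gam eps *m The eps = 1%:M.
  by move=> e_gt0; apply: degree_diag_mul => i _; rewrite mulfV // expf_neq0 // gt_eqF.
pose P (eps : R) :=
  \sum_(i < k.*2.+1) \sum_(j < k.*2.+1) block_term V B eps i j.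
(* Everything is divided by [eps^(2k)]; [A] is the corner of degrees at least [k]
   together with the remainder, and [S], [Y], [M] come from completing the square. *)
pose Err (eps : R) := eps ^- k.*2 *: (L eps - P eps).
pose A eps := V k *m B k k *m (V k)^T + Err eps.
pose S eps := A eps - G eps *m invmx W *m (G eps)^T.
pose Y eps := Vstar + G eps *m invmx W *m Gam eps.
pose M eps := The eps *m W *m The eps.
have LstarE : Lstar = V k *m B k k *m (V k)^T
    - (V k *m Bk) *m invmx W *m (V k *m Bk)^T.
  rewrite /Lstar /Wbar /wronskian_schur Wkk Wll Wur Wlt mulmxBr mulmxBl.
  by rewrite trmx_mul !mulmxA.
have Err_lim : mxcvg 0^'+ Err 0.
  move=> l l'; rewrite mxE; pose D := enorm (x l - x l').
  have D_ge0 : 0 <= D by exact: enorm_ge0.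
  have D1_gt0 : 0 < D + 1 by rewrite ltr_wpDl.
  apply: (@cvg_right_linear _ _ (`|C| * D ^+ k.*2.+1) (rho / (D + 1))).
    by rewrite divr_gt0.
  move=> eps /andP[e_gt0 e_small].
  have De : enorm (eps *: x l - eps *: x l') = eps * D.
    by rewrite -scalerBr enormZ // ltW.
  have De_rho : enorm (eps *: x l - eps *: x l') < rho.
    rewrite De; apply: le_lt_trans (_ : eps * (D + 1) < _).
      by rewrite ler_wpM2l ?lerDl // ltW.
    by rewrite -ltr_pdivlMr.
  have -> : Err eps l l' = eps ^- k.*2 *
      (kappa (eps *: x l) (eps *: x l') - bieval s (eps *: x l) (eps *: x l')).
    rewrite (bieval_blocks e_enum x eps l l' s_D) kappa_stat De.
    by rewrite /Err !mxE.
  have e2_gt0 : 0 < eps ^+ k.*2 by rewrite exprn_gt0.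
  rewrite normrM gtr0_norm ?invr_gt0 // mulrC ler_pdivrMr //.
  apply: le_trans (kb _ _ De_rho) _; rewrite De.
  apply: le_trans (_ : `|C| * (eps * D) ^+ k.*2.+1 <= _).
    apply: ler_wpM2r; last exact: ler_norm.
    by rewrite exprn_ge0 // mulr_ge0 // ltW.
  rewrite exprMn [eps ^+ k.*2.+1]exprS le_eqVlt; apply/orP; left; apply/eqP.
  by ring.
have G_lim : mxcvg 0^'+ G (V k *m Bk) by exact: cvg_high_part.
apply: (@partial_projection_limit _ _ _ _ L S Y M (fun eps => eps ^+ k.*2)) => //.
- move=> eps e_gt0; have e_neq0 : eps != 0 by rewrite gt_eqF.
  rewrite /S /Y /M complete_square ?tr_degree_diag ?GT //.
  have split_P := block_split V B_sym B_high e_neq0.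
  rewrite /A addrA -[X in _ *: (X + _)]split_P -scalerDr addrC subrK.
  by rewrite scalerA mulfV ?scale1r // expf_neq0.
- by move=> eps e_gt0; rewrite exprn_gt0.
- by move=> eps /GT GTe; have [] := invmx_congr W_unit GTe.
- rewrite LstarE; apply: mxcvg_add.
    rewrite -[X in mxcvg _ _ X]addr0; apply: mxcvg_add => //; exact: mxcvg_cst.
  apply: mxcvg_opp; apply: mxcvg_mul; last exact: mxcvg_tr.
  by apply: mxcvg_mul => //; exact: mxcvg_cst.
- rewrite -[X in mxcvg _ _ X]addr0; apply: mxcvg_add; first exact: mxcvg_cst.
  rewrite -(mulmx0 _ (V k *m Bk *m invmx W)); apply: mxcvg_mul.
    by apply: mxcvg_mul => //; exact: mxcvg_cst.
  exact: cvg_degree_diag.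
- apply: (@mxcvg_near _ _ _ _ (fun eps => Gam eps *m invmx W *m Gam eps)).
    by move=> eps /GT GTe; have [] := invmx_congr W_unit GTe.
  rewrite -(mulmx0 _ (0 *m invmx W)); apply: mxcvg_mul; last exact: cvg_degree_diag.
  by apply: mxcvg_mul; [exact: cvg_degree_diag | exact: mxcvg_cst].
- rewrite LstarE linearB /= !trmx_mul !trmxK B_sym trmx_inv symW.
  by rewrite !mulmxA.
Qed.
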